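(* For all $\tau\in\mathbb{H}$, $$s\!\left(\frac{-1}{\tau}\right)=\frac{\varepsilon_1 s(\tau)-\eta_3 t(\tau)+1}{s(\tau)-\varepsilon_1 t(\tau)-\eta_3}=\frac{\varepsilon_1 s(\tau)+(\varepsilon_1^2-\varepsilon_1-1)t(\tau)+1}{s(\tau)-\varepsilon_1 t(\tau)+\varepsilon_1^2-\varepsilon_1-1},$$ $$t\!\left(\frac{-1}{\tau}\right)=\frac{-\eta_3 s(\tau)-t(\tau)-\varepsilon_1}{s(\tau)-\varepsilon_1 t(\tau)-\eta_3}=\frac{(\varepsilon_1^2-\varepsilon_1-1)s(\tau)-t(\tau)-\varepsilon_1}{s(\tau)-\varepsilon_1 t(\tau)+\varepsilon_1^2-\varepsilon_1-1}.$$
   Context: Let $\tau\in\mathbb{H}$, $q=e^{2\pi i\tau}$, $q^{\alpha}=e^{2\pi i\alpha\tau}$. Define $s(\tau)=q^{-3/7}\prod_{n\ge1}\frac{(1-q^{7n-3})(1-q^{7n-4})}{(1-q^{7n-1})(1-q^{7n-6})}$ and $t(\tau)=q^{-2/7}\prod_{n\ge1}\frac{(1-q^{7n-2})(1-q^{7n-5})}{(1-q^{7n-1})(1-q^{7n-6})}$ (so $s=u/w$, $t=v/w$ with $u=q^{1/56}\prod_{k\ge0}(1-q^{7k+3})(1-q^{7k+4})(1-q^{7k+7})$, $v=q^{9/56}\prod_{k\ge0}(1-q^{7k+2})(1-q^{7k+5})(1-q^{7k+7})$, $w=q^{25/56}\prod_{k\ge0}(1-q^{7k+1})(1-q^{7k+6})(1-q^{7k+7})$).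 Let $\zeta_7=e^{2\pi i/7}$, $\eta_i=\zeta_7^i+\zeta_7^{-i}$, and $\varepsilon_1=1+\eta_1=1+\zeta_7+\zeta_7^6$. *)

(* Defs.v *)
From Stdlib Require Import Reals.
From Coquelicot Require Import Coquelicot.
Open Scope R_scope.

Definition cexp (z : C) : C :=
  (exp (Re z) * cos (Im z), exp (Re z) * sin (Im z)).

Definition qpow (alpha : R) (tau : C) : C :=
  cexp (Cmult ((0, 2 * PI * alpha) : C) tau).

Fixpoint cpartprod (f : nat -> C) (N : nat) : C :=
  match N with
  | O => RtoC 1
  | S M => Cmult (cpartprod f M) (f (S M))
  end.

Definition cinfprod (f : nat -> C) : C :=
  @lim (CompleteNormedModule.CompleteSpace _ C_CompleteNormedModule)
    (filtermap (cpartprod f) eventually).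

Definition omq (tau : C) (m : R) : C := Cminus (RtoC 1) (qpow m tau).

Definition s_fun (tau : C) : C :=
  Cmult (qpow (-3/7) tau)
    (cinfprod (fun n => let k := 7 * INR n in
       Cdiv (Cmult (omq tau (k - 3)) (omq tau (k - 4)))
            (Cmult (omq tau (k - 1)) (omq tau (k - 6))))).

Definition t_fun (tau : C) : C :=
  Cmult (qpow (-2/7) tau)
    (cinfprod (fun n => let k := 7 * INR n in
       Cdiv (Cmult (omq tau (k - 2)) (omq tau (k - 5)))
            (Cmult (omq tau (k - 1)) (omq tau (k - 6))))).

Definition zeta7 : C := cexp ((0, 2 * PI / 7) : C).

Definition eta (i : nat) : C := Cplus (Cpow zeta7 i) (Cinv (Cpow zeta7 i)).

Definition eps1 : C := Cplus (RtoC 1) (eta 1).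

(* Main.v *)
Require Import Defs.
From Stdlib Require Import Reals ZArith Psatz.
From Coquelicot Require Import Coquelicot.
Open Scope C_scope.

(** The Jacobi triple product turns [s] and [t] into quotients [T1 / T5] and [T3 / T5] of the
    theta series [T_i(tau) = sum_n (-1)^n q^((14 n + i)^2 / 56)].  Poisson summation for the
    Gaussian [e^(- a x^2 + i pi x)] with [a = 7 pi i / tau], evaluated at [x = i / 14] and with
    the dual index folded modulo 7, gives
    [T_i(-1/tau) = A (c_i T1 + c_3i T3 + c_5i T5)] with [c_k = 2 cos (pi k / 14)] and a factor
    [A] independent of [i].  As only quotients matter, [A] is never computed: it suffices that the
    Fourier coefficients of the periodized Gaussian are proportional to the expected ones, which
    follows by shifting the line of integration.  Nonvanishing of the product for [T5(-1/tau)]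
    shows that [A] and the denominators are nonzero. *)

(** * Convergence of complex sequences and bilateral sums *)

(** The value [a = 7 pi i / tau] comes from [14^2 / 56 = 7 / 2]: at [-1/tau] the terms of [T_i] are
    [(-1)^n exp (- a (n + i/14)^2)]. The sign [(-1)^n] is carried by [e^(i pi x)], which moves the
    dual frequencies to the half-integers [k - 1/2]; these give back the exponents [(2k - 1)^2 / 56]
    with [2k - 1] odd. Modulo 14 the odd residues are 7, whose series is its own negative under
    reflection, and the pairs +-1, +-3, +-5, so three theta series span a stable space. The
    relations [c_1 = c_5 eps1] and [c_3 = - c_5 eta_3] then extract [A c_5] from all three rows and
    leave the coefficients of the stated fractions.

    Series are controlled by explicit geometric rates, uniform in [x] on a compact interval, which
    yields continuity and termwise integration. Proportional Fourier coefficients suffice because a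
    continuous function is determined by its coefficients, so pointwise convergence of Fourier
    series never enters. *)

Definition Ccv (u : nat -> C) (l : C) : Prop :=
  is_lim_seq (fun n => Cmod (u n - l)) 0%R.

Lemma Cmod_le_abs (z : C) : (Cmod z <= Rabs (fst z) + Rabs (snd z))%R.
Proof.
  replace z with ((RtoC (fst z) + Ci * RtoC (snd z))%C) at 1.
  - eapply Rle_trans; [apply Cmod_triangle|].
    rewrite Cmod_mult, Cmod_Ci, !Cmod_R; lra.
  - destruct z as [a b]; unfold RtoC, Ci, Cplus, Cmult; simpl; f_equal; ring.
Qed.

Lemma fst_le_Cmod (z : C) : (Rabs (fst z) <= Cmod z)%R.
Proof. eapply Rle_trans; [|apply Rmax_Cmod]; apply Rmax_l. Qed.

Lemma snd_le_Cmod (z : C) : (Rabs (snd z) <= Cmod z)%R.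
Proof. eapply Rle_trans; [|apply Rmax_Cmod]; apply Rmax_r. Qed.

Lemma Cmod_minus_sym (x y : C) : Cmod (x - y) = Cmod (y - x).
Proof. replace (x - y) with (- (y - x)) by ring; apply Cmod_opp. Qed.

Lemma Cmod_minus_triangle (x y z : C) : (Cmod (x - z) <= Cmod (x - y) + Cmod (y - z))%R.
Proof. replace (x - z) with ((x - y) + (y - z)) by ring; apply Cmod_triangle. Qed.

Lemma Ccv_le (u : nat -> C) (l : C) (b : nat -> R) :
  (forall n, Cmod (u n - l) <= b n)%R -> is_lim_seq b 0%R -> Ccv u l.
Proof.
  intros H Hb; apply is_lim_seq_le_le with (u := fun _ => 0%R) (w := b); auto.
  - intros n; split; [apply Cmod_ge_0|apply H].
  - apply is_lim_seq_const.
Qed.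

Lemma Ccv_eps (u : nat -> C) (l : C) :
  Ccv u l <-> (forall eps : R, 0 < eps -> exists N, forall n, (N <= n)%nat -> Cmod (u n - l) < eps)%R.
Proof.
  unfold Ccv; rewrite <- is_lim_seq_spec; split.
  - intros H eps He; destruct (H (mkposreal eps He)) as [N HN]; exists N; intros n Hn.
    specialize (HN n Hn); simpl in HN.
    rewrite Rminus_0_r, Rabs_pos_eq in HN by apply Cmod_ge_0; exact HN.
  - intros H [eps He]; destruct (H eps He) as [N HN]; exists N; intros n Hn; simpl.
    rewrite Rminus_0_r, Rabs_pos_eq by apply Cmod_ge_0; auto.
Qed.

Lemma Ccv_const (l : C) : Ccv (fun _ => l) l.
Proof.
  apply Ccv_eps; intros eps He; exists O; intros n _.
  replace (l - l) with (RtoC 0) by ring; rewrite Cmod_0; lra.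
Qed.

Lemma Ccv_ext (u v : nat -> C) (l : C) : (forall n, u n = v n) -> Ccv u l -> Ccv v l.
Proof. intros H; apply is_lim_seq_ext; intros n; rewrite H; reflexivity. Qed.

Lemma Ccv_unique (u : nat -> C) (l m : C) : Ccv u l -> Ccv u m -> l = m.
Proof.
  intros Hl Hm.
  assert (H : is_lim_seq (fun _ : nat => Cmod (l - m)) 0%R).
  { apply is_lim_seq_le_le with (u := fun _ => 0%R)
      (w := fun n => (Cmod (u n - l) + Cmod (u n - m))%R).
    - intros n; split; [apply Cmod_ge_0|].
      rewrite (Cmod_minus_sym (u n) l); apply Cmod_minus_triangle.
    - apply is_lim_seq_const.
    - replace 0%R with (0 + 0)%R by ring; apply is_lim_seq_plus'; assumption. }
  apply is_lim_seq_unique in H; rewrite Lim_seq_const in H; injection H as H.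
  apply Cmod_eq_0 in H.
  replace l with ((l - m) + m) by ring; rewrite H; ring.
Qed.

Lemma Ccv_plus (u v : nat -> C) (l m : C) :
  Ccv u l -> Ccv v m -> Ccv (fun n => u n + v n) (l + m).
Proof.
  intros Hu Hv.
  apply Ccv_le with (b := fun n => (Cmod (u n - l) + Cmod (v n - m))%R).
  - intros n; replace (u n + v n - (l + m)) with ((u n - l) + (v n - m)) by ring.
    apply Cmod_triangle.
  - replace 0%R with (0 + 0)%R by ring; apply is_lim_seq_plus'; assumption.
Qed.

Lemma Ccv_mult (u v : nat -> C) (l m : C) :
  Ccv u l -> Ccv v m -> Ccv (fun n => u n * v n) (l * m).
Proof.
  intros Hu Hv.
  apply Ccv_le with (b := fun n => (Cmod (u n - l) * Cmod (v n - m)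
    + (Cmod l * Cmod (v n - m) + Cmod m * Cmod (u n - l)))%R).
  - intros n; rewrite <- !Cmod_mult.
    replace (u n * v n - l * m)
      with ((u n - l) * (v n - m) + (l * (v n - m) + m * (u n - l))) by ring.
    eapply Rle_trans; [apply Cmod_triangle|].
    apply Rplus_le_compat_l, Cmod_triangle.
  - replace 0%R with (0 * 0 + (Cmod l * 0 + Cmod m * 0))%R by ring.
    apply is_lim_seq_plus'; [apply is_lim_seq_mult'; assumption|].
    apply is_lim_seq_plus'; apply is_lim_seq_mult'; try assumption; apply is_lim_seq_const.
Qed.

Lemma Ccv_scal (c : C) (u : nat -> C) (l : C) : Ccv u l -> Ccv (fun n => c * u n) (c * l).
Proof. apply Ccv_mult, Ccv_const. Qed.

Lemma Ccv_minus (u v : nat -> C) (l m : C) :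
  Ccv u l -> Ccv v m -> Ccv (fun n => u n - v n) (l - m).
Proof.
  intros Hu Hv; replace (l - m) with (l + (-(1)) * m) by ring.
  apply Ccv_ext with (fun n => u n + (-(1)) * v n); [intros; ring|].
  apply Ccv_plus; [|apply Ccv_scal]; assumption.
Qed.

Lemma Ccv_subseq (u : nat -> C) (l : C) (f : nat -> nat) :
  (forall n, (n <= f n)%nat) -> Ccv u l -> Ccv (fun n => u (f n)) l.
Proof.
  intros Hf; rewrite !Ccv_eps; intros H eps He; destruct (H eps He) as [N HN].
  exists N; intros n Hn; apply HN; specialize (Hf n); lia.
Qed.

Lemma Ccv_incr (u : nat -> C) (l : C) (k : nat) : Ccv (fun n => u (n + k)%nat) l -> Ccv u l.
Proof.
  rewrite !Ccv_eps; intros H eps He; destruct (H eps He) as [N HN].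
  exists (N + k)%nat; intros n Hn.
  replace n with ((n - k) + k)%nat by lia; apply HN; lia.
Qed.

Lemma Ccv_inv (u : nat -> C) (l : C) : l <> 0 -> Ccv u l -> Ccv (fun n => / u n) (/ l).
Proof.
  intros Hl H; assert (Hp : (0 < Cmod l)%R) by (apply Cmod_gt_0; exact Hl).
  rewrite Ccv_eps in H |- *; intros eps He.
  (* The first bound keeps [Cmod (u n)] above [Cmod l / 2]. Then [|1/u - 1/l| = |u - l| / (|u| |l|)]
     is below [2 |u - l| / |l|^2], whence the second bound. *)
  destruct (H (Rmin (Cmod l / 2) (eps * (Cmod l * Cmod l / 2)))) as [N HN].
  { apply Rmin_glb_lt; [lra|]; apply Rmult_lt_0_compat; [lra|]; nra. }
  exists N; intros n Hn; specialize (HN n Hn).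
  assert (H1 : (Cmod (u n - l) < Cmod l / 2)%R) by (eapply Rlt_le_trans; [exact HN|apply Rmin_l]).
  assert (H2 : (Cmod (u n - l) < eps * (Cmod l * Cmod l / 2))%R)
    by (eapply Rlt_le_trans; [exact HN|apply Rmin_r]).
  assert (H3 : (Cmod l / 2 < Cmod (u n))%R).
  { assert (Cmod l <= Cmod (u n) + Cmod (u n - l))%R; [|lra].
    rewrite (Cmod_minus_sym (u n)).
    replace l with (u n + (l - u n)) at 1 by ring; apply Cmod_triangle. }
  assert (Hu : u n <> 0) by (apply Cmod_gt_0; lra).
  replace (/ u n - / l) with ((l - u n) / (u n * l)) by (field; auto).
  rewrite Cmod_div, Cmod_mult, Cmod_minus_sym by (apply Cmult_neq_0; auto).
  apply Rmult_lt_reg_r with (Cmod (u n) * Cmod l)%R; [nra|].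
  unfold Rdiv; rewrite Rmult_assoc, Rinv_l, Rmult_1_r by nra.
  eapply Rlt_le_trans; [exact H2|]; apply Rmult_le_compat_l; nra.
Qed.

Lemma Ccv_div (u v : nat -> C) (l m : C) :
  m <> 0 -> Ccv u l -> Ccv v m -> Ccv (fun n => u n / v n) (l / m).
Proof. intros Hm Hu Hv; apply Ccv_mult; [|apply Ccv_inv]; assumption. Qed.

Lemma Ccv_components (u : nat -> C) (a b : R) :
  is_lim_seq (fun n => fst (u n)) a -> is_lim_seq (fun n => snd (u n)) b -> Ccv u (a, b).
Proof.
  intros Ha Hb.
  apply Ccv_le with (b := fun n => (Rabs (fst (u n) - a) + Rabs (snd (u n) - b))%R).
  - intros n; apply Cmod_le_abs.
  - replace 0%R with (Rabs (a - a) + Rabs (b - b))%R by (rewrite !Rminus_diag, Rabs_R0; ring).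
    apply is_lim_seq_plus'; apply (is_lim_seq_abs _ (Finite _));
      apply is_lim_seq_minus'; auto; apply is_lim_seq_const.
Qed.

Lemma is_lim_seq_geom0 (A r : R) : (0 <= r < 1)%R -> is_lim_seq (fun n => A * r ^ n)%R 0%R.
Proof.
  intros Hr; replace (Finite 0) with (Rbar_mult (Finite A) (Finite 0)) by (simpl; f_equal; ring).
  apply is_lim_seq_scal_l, is_lim_seq_geom; rewrite Rabs_pos_eq; lra.
Qed.

Lemma Ccv_geom_rate (u : nat -> C) (l : C) (A r : R) :
  (0 <= r < 1)%R -> (forall n, Cmod (u n - l) <= A * r ^ n)%R -> Ccv u l.
Proof. intros Hr H; eapply Ccv_le; [exact H|apply is_lim_seq_geom0; exact Hr]. Qed.

Lemma geom_step_bound (u : nat -> C) (A r : R) : (0 <= r < 1)%R ->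
  (forall n, Cmod (u (S n) - u n) <= A * r ^ n)%R ->
  forall n k, (Cmod (u (n + k)%nat - u n) <= A / (1 - r) * r ^ n)%R.
Proof.
  intros Hr H n k.
  assert (HA : (0 <= A)%R).
  { specialize (H O); pose proof (Cmod_ge_0 (u 1%nat - u O)); simpl in H; lra. }
  (* The exact partial geometric sum is carried, since the cruder final bound is not inductive in
     [k]. *)
  assert (Hk : (Cmod (u (n + k)%nat - u n) <= A / (1 - r) * (r ^ n - r ^ (n + k)))%R).
  { induction k as [|k IH].
    - rewrite Nat.add_0_r; replace (u n - u n) with (RtoC 0) by ring; rewrite Cmod_0; lra.
    - eapply Rle_trans; [apply Cmod_minus_triangle with (y := u (n + k)%nat)|].
      rewrite Nat.add_succ_r; specialize (H (n + k)%nat).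
      replace (A / (1 - r) * (r ^ n - r ^ S (n + k)))%R
        with (A * r ^ (n + k) + A / (1 - r) * (r ^ n - r ^ (n + k)))%R
        by (simpl; field; lra).
      lra. }
  eapply Rle_trans; [exact Hk|]; apply Rmult_le_compat_l.
  - apply Rmult_le_pos; [lra|]; apply Rlt_le, Rinv_0_lt_compat; lra.
  - pose proof (pow_le r (n + k) (proj1 Hr)); lra.
Qed.

(** Completeness of the reals is applied to each component. The explicit rate matters later: its
    constant depends only on [A] and [r], so for functions it becomes uniform convergence. *)
Lemma geom_limit (u : nat -> C) (A r : R) : (0 <= r < 1)%R ->
  (forall n, Cmod (u (S n) - u n) <= A * r ^ n)%R ->
  exists l, forall n, (Cmod (u n - l) <= A / (1 - r) * r ^ n)%R.
Proof.
  intros Hr H.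
  assert (Hex : forall p : C -> R, (forall z, Rabs (p z) <= Cmod z)%R ->
    (forall x y : C, p (Cminus x y) = (p x - p y)%R) ->
    exists l : R, is_lim_seq (fun n => p (u n)) l).
  { intros p Hp Hm.
    apply ex_lim_seq_cauchy_corr; intros [eps He]; simpl.
    assert (Hg := is_lim_seq_geom0 (A / (1 - r)) r Hr).
    apply is_lim_seq_spec in Hg.
    assert (He2 : (0 < eps / 2)%R) by lra.
    destruct (Hg (mkposreal _ He2)) as [N HN]; simpl in HN.
    specialize (HN N (le_n N)); rewrite Rminus_0_r in HN.
    assert (HB : forall n, (N <= n)%nat -> (Cmod (u n - u N) < eps / 2)%R).
    { intros n Hn; replace n with (N + (n - N))%nat by lia.
      eapply Rle_lt_trans; [apply geom_step_bound; eassumption|].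
      eapply Rle_lt_trans; [apply Rle_abs|exact HN]. }
    exists N; intros n m Hn Hm'.
    apply Rle_lt_trans with (Cmod (u n - u m)); [rewrite <- (Hm (u n) (u m)); apply Hp|].
    eapply Rle_lt_trans; [apply Cmod_minus_triangle with (y := u N)|].
    rewrite (Cmod_minus_sym (u N)).
    pose proof (HB n Hn); pose proof (HB m Hm'); lra. }
  destruct (Hex fst fst_le_Cmod) as [a Ha]; [intros [] []; simpl; ring|].
  destruct (Hex snd snd_le_Cmod) as [b Hb]; [intros [] []; simpl; ring|].
  exists (a, b); intros n.
  pose proof (Ccv_components u a b Ha Hb) as Hc; rewrite Ccv_eps in Hc.
  apply le_epsilon; intros eps He; destruct (Hc eps He) as [N HN].
  specialize (HN (n + N)%nat ltac:(lia)).
  eapply Rle_trans; [apply Cmod_minus_triangle with (y := u (n + N)%nat)|].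
  rewrite (Cmod_minus_sym (u n)).
  pose proof (geom_step_bound u A r Hr H n N); lra.
Qed.

(** [lim] is a total operator on filters, specified only for proper Cauchy ones. Convergence
    supplies the Cauchy property, and uniqueness of filter limits in [C] identifies the value. *)
Lemma cinfprod_eq (f : nat -> C) (l : C) : Ccv (cpartprod f) l -> cinfprod f = l.
Proof.
  intros H; unfold cinfprod.
  assert (Hl : filterlim (cpartprod f) eventually (@locally C_UniformSpace l)).
  { intros P [eps HP]; rewrite Ccv_eps in H; destruct (H eps (cond_pos eps)) as [N HN].
    exists N; intros n Hn; apply HP.
    apply (C_NormedModule_mixin_compat1 l); exact (HN n Hn). }
  set (F := filtermap (cpartprod f) eventually).
  assert (PF : ProperFilter F) by (apply filtermap_proper_filter; apply eventually_filter).
  assert (Hball : forall eps : posreal, F (@ball C_UniformSpace l eps)).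
  { intros eps; apply Hl; exists eps; auto. }
  assert (Hc : @cauchy C_UniformSpace F) by (intros eps; exists l; apply Hball).
  assert (Hlim := @complete_cauchy (CompleteNormedModule.CompleteSpace _ C_CompleteNormedModule)
    F PF Hc).
  set (m := @lim (CompleteNormedModule.CompleteSpace _ C_CompleteNormedModule) F) in *.
  apply (@is_filter_lim_unique C_AbsRing C_NormedModule F _ m l).
  - intros P [eps HP]; apply filter_imp with (2 := Hlim eps); exact HP.
  - exact Hl.
Qed.

(** * Partial sums over nearly symmetric windows *)

Definition csum (p : nat -> C) : nat -> C :=
  fix go N := match N with O => RtoC 0 | S M => go M + p M end.

(* Sum over the window [-N, N - 1], which is invariant under [n -> - n - 1]
   and splits exactly into residue classes. *)
Definition zsum (a : Z -> C) : nat -> C :=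
  csum (fun n => a (Z.of_nat n) + a (- Z.of_nat n - 1)%Z).

Lemma csum_ext (p q : nat -> C) (N : nat) :
  (forall n, p n = q n) -> csum p N = csum q N.
Proof. intros H; induction N as [|N IH]; simpl; [|rewrite IH, H]; reflexivity. Qed.

Lemma csum_plus (p q : nat -> C) (N : nat) :
  csum (fun n => p n + q n) N = csum p N + csum q N.
Proof. induction N as [|N IH]; simpl; [|rewrite IH]; ring. Qed.

Lemma csum_scal (c : C) (p : nat -> C) (N : nat) :
  csum (fun n => c * p n) N = c * csum p N.
Proof. induction N as [|N IH]; simpl; [|rewrite IH]; ring. Qed.

Lemma zsum_ext (a b : Z -> C) (N : nat) : (forall n, a n = b n) -> zsum a N = zsum b N.
Proof. intros H; apply csum_ext; intros n; rewrite !H; reflexivity. Qed.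

Lemma zsum_plus (a b : Z -> C) (N : nat) :
  zsum (fun n => a n + b n) N = zsum a N + zsum b N.
Proof. unfold zsum; rewrite <- csum_plus; apply csum_ext; intros; ring. Qed.

Lemma zsum_scal (c : C) (a : Z -> C) (N : nat) :
  zsum (fun n => c * a n) N = c * zsum a N.
Proof. unfold zsum; rewrite <- csum_scal; apply csum_ext; intros; ring. Qed.

Lemma zsum_S (a : Z -> C) (N : nat) :
  zsum a (S N) = zsum a N + a (Z.of_nat N) + a (- Z.of_nat N - 1)%Z.
Proof. unfold zsum; simpl; ring. Qed.

Lemma zsum_shift (a : Z -> C) (N : nat) :
  zsum (fun n => a (n + 1)%Z) N = zsum a N + a (Z.of_nat N) - a (- Z.of_nat N)%Z.
Proof.
  induction N as [|N IH]; [simpl; unfold zsum; simpl; ring|].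
  rewrite !zsum_S, IH.
  replace (Z.of_nat N + 1)%Z with (Z.of_nat (S N)) by lia.
  replace (- Z.of_nat N - 1 + 1)%Z with (- Z.of_nat N)%Z by lia.
  replace (- Z.of_nat N - 1)%Z with (- Z.of_nat (S N))%Z by lia.
  ring.
Qed.

Lemma zsum_shift_back (a : Z -> C) (N : nat) :
  zsum (fun n => a (n - 1)%Z) N = zsum a N - a (Z.of_nat N - 1)%Z + a (- Z.of_nat N - 1)%Z.
Proof.
  pose proof (zsum_shift (fun n => a (n - 1)%Z) N) as H; simpl in H.
  rewrite (zsum_ext _ a) in H by (intros; f_equal; lia).
  rewrite H; ring.
Qed.

Lemma zsum_reflect (a : Z -> C) (N : nat) : zsum (fun n => a (- n - 1)%Z) N = zsum a N.
Proof.
  apply csum_ext; intros n.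
  replace (- (- Z.of_nat n - 1) - 1)%Z with (Z.of_nat n) by lia; ring.
Qed.

Lemma zsum_mod7 (a : Z -> C) (N : nat) :
  zsum a (7 * N) = zsum (fun m => a (7 * m)%Z + a (7 * m + 1)%Z + a (7 * m + 2)%Z
    + a (7 * m + 3)%Z + a (7 * m + 4)%Z + a (7 * m + 5)%Z + a (7 * m + 6)%Z) N.
Proof.
  induction N as [|N IH]; [reflexivity|].
  replace (7 * S N)%nat with (S (S (S (S (S (S (S (7 * N)))))))) by lia.
  rewrite !zsum_S, IH.
  repeat match goal with |- context [Z.of_nat (S ?x)] => rewrite (Nat2Z.inj_succ x) end.
  rewrite Nat2Z.inj_mul; change (Z.of_nat 7) with 7%Z; set (z := Z.of_nat N).
  unfold Z.succ.
  replace (7 * z + 1 + 1 + 1 + 1 + 1 + 1)%Z with (7 * z + 6)%Z by ring.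
  replace (7 * z + 1 + 1 + 1 + 1 + 1)%Z with (7 * z + 5)%Z by ring.
  replace (7 * z + 1 + 1 + 1 + 1)%Z with (7 * z + 4)%Z by ring.
  replace (7 * z + 1 + 1 + 1)%Z with (7 * z + 3)%Z by ring.
  replace (7 * z + 1 + 1)%Z with (7 * z + 2)%Z by ring.
  (* The seven new negative indices form the block [m = - z - 1], with the residues met in reverse
     order. *)
  replace (- (7 * z) - 1)%Z with (7 * (- z - 1) + 6)%Z by ring.
  replace (- (7 * z + 1) - 1)%Z with (7 * (- z - 1) + 5)%Z by ring.
  replace (- (7 * z + 2) - 1)%Z with (7 * (- z - 1) + 4)%Z by ring.
  replace (- (7 * z + 3) - 1)%Z with (7 * (- z - 1) + 3)%Z by ring.
  replace (- (7 * z + 4) - 1)%Z with (7 * (- z - 1) + 2)%Z by ring.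
  replace (- (7 * z + 5) - 1)%Z with (7 * (- z - 1) + 1)%Z by ring.
  replace (- (7 * z + 6) - 1)%Z with (7 * (- z - 1))%Z by ring.
  ring.
Qed.

Lemma csum_limit (p : nat -> C) (A r : R) : (0 <= r < 1)%R ->
  (forall n, Cmod (p n) <= A * r ^ n)%R ->
  exists l, forall n, (Cmod (csum p n - l) <= A / (1 - r) * r ^ n)%R.
Proof.
  intros Hr H; apply geom_limit; [exact Hr|].
  intros n; simpl; replace (csum p n + p n - csum p n) with (p n) by ring; apply H.
Qed.

(** Tannery's theorem, that is, dominated convergence for series. The geometric majorant makes the
    tails beyond [M] small uniformly in [N], so the limit in [N] is only taken in finitely many
    terms. *)
Lemma csum_tannery (p : nat -> nat -> C) (q : nat -> C) (f : nat -> nat) (L : C) (A r : R) :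
  (0 <= r < 1)%R -> (forall N n, Cmod (p N n) <= A * r ^ n)%R ->
  (forall n, Ccv (fun N => p N n) (q n)) -> Ccv (csum q) L ->
  (forall N, (N <= f N)%nat) -> Ccv (fun N => csum (p N) (f N)) L.
Proof.
  intros Hr Hb Hp Hq Hf.
  assert (Hfin : forall M, Ccv (fun N => csum (p N) M) (csum q M)).
  { induction M as [|M IH]; simpl; [apply Ccv_const|apply Ccv_plus; auto]. }
  apply Ccv_eps; intros eps He; assert (He3 : (0 < eps / 3)%R) by lra.
  assert (Hg := Ccv_geom_rate (fun n => RtoC (A / (1 - r) * r ^ n)) 0 (Rabs (A / (1 - r))) r Hr).
  rewrite Ccv_eps in Hg, Hq.
  destruct (Hg) with (eps := (eps / 3)%R) as [M1 HM1]; [|exact He3|].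
  { intros n; unfold Cminus; replace (-0) with (RtoC 0) by ring; rewrite Cplus_0_r, Cmod_R, Rabs_mult.
    rewrite (Rabs_pos_eq (r ^ n)) by (apply pow_le; lra); lra. }
  destruct (Hq _ He3) as [M2 HM2].
  (* [M] makes both the common tail bound and the remainder of the limit series less than [eps / 3];
     [N0] then settles the head of length [M]. *)
  set (M := Nat.max M1 M2).
  specialize (Hfin M); rewrite Ccv_eps in Hfin; destruct (Hfin _ He3) as [N0 HN0].
  exists (Nat.max M N0); intros N HN.
  specialize (HM1 M ltac:(lia)); specialize (HM2 M ltac:(lia)); specialize (HN0 N ltac:(lia)).
  unfold Cminus in HM1; replace (-0) with (RtoC 0) in HM1 by ring.
  rewrite Cplus_0_r, Cmod_R in HM1.
  assert (H1 : (Cmod (csum (p N) (f N) - csum (p N) M) <= A / (1 - r) * r ^ M)%R).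
  { specialize (Hf N); replace (f N) with (M + (f N - M))%nat by lia.
    apply geom_step_bound; [exact Hr|].
    intros n; simpl; replace (csum (p N) n + p N n - csum (p N) n) with (p N n) by ring; apply Hb. }
  eapply Rle_lt_trans; [apply Cmod_minus_triangle with (y := csum (p N) M)|].
  pose proof (Cmod_minus_triangle (csum (p N) M) (csum q M) L).
  pose proof (Rle_abs (A / (1 - r) * r ^ M)); lra.
Qed.

(** * The Jacobi triple product *)

Lemma C_eq (z w : C) : fst z = fst w -> snd z = snd w -> z = w.
Proof. destruct z, w; simpl; intros -> ->; reflexivity. Qed.

Lemma cexp_plus (z w : C) : cexp (z + w) = cexp z * cexp w.
Proof.
  destruct z as [a b], w as [c d]; unfold cexp; simpl.
  rewrite exp_plus, cos_plus, sin_plus; apply C_eq; simpl; ring.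
Qed.

Lemma cexp_0 : cexp 0 = 1.
Proof. unfold cexp; simpl; rewrite exp_0, cos_0, sin_0; apply C_eq; simpl; ring. Qed.

Lemma Cmod_cexp (z : C) : Cmod (cexp z) = exp (Re z).
Proof.
  unfold cexp, Cmod; simpl.
  replace (_ + _)%R with (exp (Re z) * exp (Re z) * (Rsqr (sin (Im z)) + Rsqr (cos (Im z))))%R
    by (unfold Rsqr; ring).
  rewrite sin2_cos2, Rmult_1_r; apply sqrt_square, Rlt_le, exp_pos.
Qed.

Lemma cexp_neq_0 (z : C) : cexp z <> 0.
Proof. apply Cmod_gt_0; rewrite Cmod_cexp; apply exp_pos. Qed.

(** The sign [(-1)^j], defined by parity because [j] may be negative. *)
Definition zsgn (j : Z) : C := if Z.even j then 1 else -(1).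

Lemma zsgn_succ (j : Z) : zsgn (j + 1) = - zsgn j.
Proof.
  unfold zsgn; replace (j + 1)%Z with (Z.succ j) by lia.
  rewrite Z.even_succ, <- Z.negb_even; destruct (Z.even j); simpl; ring.
Qed.

Lemma zsgn_pred (j : Z) : zsgn (j - 1) = - zsgn j.
Proof. replace j with (j - 1 + 1)%Z at 2 by lia; rewrite zsgn_succ; ring. Qed.

Lemma zsgn_opp (j : Z) : zsgn (- j) = zsgn j.
Proof. unfold zsgn; rewrite Z.even_opp; reflexivity. Qed.

Lemma Cmod_zsgn (j : Z) : Cmod (zsgn j) = 1%R.
Proof. unfold zsgn; destruct (Z.even j); [apply Cmod_1|apply Cmod_m1]. Qed.

Lemma exp_le (x y : R) : (x <= y)%R -> (exp x <= exp y)%R.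
Proof. intros [H| ->]; [left; apply exp_increasing; exact H|right; reflexivity]. Qed.

(** With [u = y / (1 - rho)] one has [exp u >= 1 + u] and [(1 + u) (1 - y) >= 1]. The estimate turns
    a bound on a sum into a positive lower bound for a product. *)
Lemma one_minus_ge_exp_neg (y rho : R) :
  (0 <= y <= rho)%R -> (rho < 1)%R -> (exp (- (y / (1 - rho))) <= 1 - y)%R.
Proof.
  intros Hy Hr; rewrite exp_Ropp.
  assert (H1 := exp_ineq1_le (y / (1 - rho))).
  assert (H0 : (0 <= y / (1 - rho))%R) by (apply Rdiv_le_0_compat; lra).
  apply Rmult_le_reg_l with (exp (y / (1 - rho))); [apply exp_pos|].
  rewrite Rinv_r by (apply Rgt_not_eq, exp_pos).
  apply Rle_trans with ((1 + y / (1 - rho)) * (1 - y))%R; [|apply Rmult_le_compat_r; lra].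
  replace ((1 + y / (1 - rho)) * (1 - y))%R with (1 + y * (rho - y) / (1 - rho))%R by (field; lra).
  assert (0 <= y * (rho - y) / (1 - rho))%R; [|lra].
  apply Rdiv_le_0_compat; [apply Rmult_le_pos|]; lra.
Qed.

(** * Convergence and nonvanishing of infinite products *)

Section Product.
Variables (x : nat -> C) (A r rho : R).
Hypothesis Hr : (0 <= r < 1)%R.
Hypothesis Hrho : (rho < 1)%R.
Hypothesis HxA : forall n, (Cmod (x (S n)) <= A * r ^ n)%R.
Hypothesis Hxr : forall n, (Cmod (x (S n)) <= rho)%R.

Let P := cpartprod (fun n => 1 - x n).

Lemma cpartprod_bounds :
  exists c D, (0 < c)%R /\ forall N, (c <= Cmod (P N) <= D)%R.
Proof.
  exists (exp (- (A / (1 - r) / (1 - rho)))), (exp (A / (1 - r))); split; [apply exp_pos|].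
  assert (HA : (0 <= A)%R).
  { specialize (HxA O); pose proof (Cmod_ge_0 (x 1%nat)); simpl in HxA; lra. }
  (* [S] is the sum of the moduli of the first [N] values [x n]; its bound is the partial geometric
     sum. *)
  assert (HS : forall N, exists S, (0 <= S <= A / (1 - r) * (1 - r ^ N))%R
    /\ (exp (- (S / (1 - rho))) <= Cmod (P N) <= exp S)%R).
  { induction N as [|N [S [HS1 [HS2 HS3]]]].
    - exists 0%R; change (P O) with (RtoC 1).
      rewrite Cmod_1; unfold Rdiv at 2; rewrite Rmult_0_l, Ropp_0, exp_0; simpl; lra.
    - exists (S + Cmod (x (Datatypes.S N)))%R.
      pose proof (Cmod_ge_0 (x (Datatypes.S N))) as Hx0.
      specialize (HxA N); specialize (Hxr N).
      unfold P; simpl; fold P; rewrite Cmod_mult; split; [split; [lra|]|].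
      + replace (A / (1 - r) * (1 - r * r ^ N))%R
          with (A / (1 - r) * (1 - r ^ N) + A * r ^ N)%R by (field; lra); lra.
      + rewrite Rdiv_plus_distr, Ropp_plus_distr, !exp_plus.
        assert (H1 : (1 - Cmod (x (Datatypes.S N)) <= Cmod (1 - x (Datatypes.S N)))%R).
        { pose proof (Cmod_triangle (1 - x (Datatypes.S N)) (x (Datatypes.S N))) as H.
          replace (1 - x (Datatypes.S N) + x (Datatypes.S N)) with (RtoC 1) in H by ring.
          rewrite Cmod_1 in H; lra. }
        assert (H2 : (Cmod (1 - x (Datatypes.S N)) <= 1 + Cmod (x (Datatypes.S N)))%R).
        { unfold Cminus; eapply Rle_trans; [apply Cmod_triangle|].
          rewrite Cmod_opp, Cmod_1; lra. }
        pose proof (one_minus_ge_exp_neg (Cmod (x (Datatypes.S N))) rho ltac:(lra) Hrho).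
        pose proof (exp_ineq1_le (Cmod (x (Datatypes.S N)))).
        split; apply Rmult_le_compat; try apply Rlt_le, exp_pos; try apply Cmod_ge_0; lra. }
  intros N; destruct (HS N) as [S [HS1 [HS2 HS3]]].
  assert (HSA : (S <= A / (1 - r))%R).
  { eapply Rle_trans; [apply HS1|]; rewrite <- (Rmult_1_r (A / (1 - r))) at 2.
    apply Rmult_le_compat_l; [apply Rdiv_le_0_compat; lra|].
    pose proof (pow_le r N (proj1 Hr)); lra. }
  split.
  - eapply Rle_trans; [|exact HS2]; apply exp_le, Ropp_le_contravar.
    apply Rmult_le_compat_r; [apply Rlt_le, Rinv_0_lt_compat; lra|exact HSA].
  - eapply Rle_trans; [exact HS3|apply exp_le; exact HSA].
Qed.

(** The increments are [- P n * x (S n)], at most [D * A * r^n] in modulus. The uniform lower bound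
    [c] keeps the limit away from 0. *)
Lemma cpartprod_limit : exists L : C, L <> 0 /\ Ccv P L.
Proof.
  destruct cpartprod_bounds as [c [D [Hc HB]]].
  destruct (geom_limit P (D * A) r Hr) as [L HL].
  - intros n; unfold P; simpl; fold P.
    replace (P n * (1 - x (S n)) - P n) with (- (P n * x (S n))) by ring.
    rewrite Cmod_opp, Cmod_mult, Rmult_assoc.
    apply Rmult_le_compat; try apply Cmod_ge_0; [apply HB|apply HxA].
  - exists L; assert (HP : Ccv P L) by (eapply Ccv_geom_rate; [exact Hr|exact HL]).
    split; [|exact HP]; intros ->.
    rewrite Ccv_eps in HP; destruct (HP c Hc) as [N HN]; specialize (HN N (le_n N)).
    replace (P N - 0) with (P N) in HN by ring; specialize (HB N); lra.
Qed.
End Product.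

Section TripleProduct.
Variable tau : C.
Hypothesis Htau : (0 < Im tau)%R.

Let E (alpha : R) : C := qpow alpha tau.

Lemma qpow_plus (a b : R) : E (a + b) = E a * E b.
Proof.
  unfold E, qpow; rewrite <- cexp_plus; f_equal; apply C_eq; simpl; ring.
Qed.

Lemma qpow_0 : E 0 = 1.
Proof.
  unfold E, qpow; rewrite <- cexp_0; f_equal; apply C_eq; simpl; ring.
Qed.

Lemma Cmod_qpow (a : R) : Cmod (E a) = exp (- (2 * PI * Im tau * a)).
Proof.
  unfold E, qpow; rewrite Cmod_cexp; f_equal; unfold Re, Im; simpl; ring.
Qed.

Lemma qpow_neq_0 (a : R) : E a <> 0.
Proof. apply cexp_neq_0. Qed.

Let rho := exp (- (2 * PI * Im tau)).

Lemma rho_bounds : (0 < rho < 1)%R.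
Proof.
  split; [apply exp_pos|]; rewrite <- exp_0; apply exp_increasing.
  pose proof PI_RGT_0; assert (0 < 2 * PI * Im tau)%R; [|lra].
  apply Rmult_lt_0_compat; [lra|exact Htau].
Qed.

Lemma exp_mult_nat (u : R) (n : nat) : exp (INR n * u) = (exp u ^ n)%R.
Proof.
  induction n as [|n IH]; [simpl; rewrite Rmult_0_l; apply exp_0|].
  rewrite S_INR; simpl; rewrite <- IH, <- exp_plus; f_equal; ring.
Qed.

Lemma Cmod_qpow_le (a : R) (n : nat) : (INR n <= a)%R -> (Cmod (E a) <= rho ^ n)%R.
Proof.
  intros H; rewrite Cmod_qpow; unfold rho; rewrite <- exp_mult_nat; apply exp_le.
  pose proof PI_RGT_0; assert (0 < 2 * PI * Im tau)%R by (apply Rmult_lt_0_compat; [lra|exact Htau]).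
  nra.
Qed.

Lemma omq_prod_limit (m : nat -> R) : (forall n, INR (S n) <= m (S n))%R ->
  exists L : C, L <> 0 /\ Ccv (cpartprod (fun n => 1 - E (m n))) L.
Proof.
  intros H; pose proof rho_bounds as Hr.
  apply cpartprod_limit with (A := 1%R) (r := rho) (rho := rho); try lra; intros n.
  - rewrite Rmult_1_l; apply Cmod_qpow_le; specialize (H n); rewrite S_INR in H; lra.
  - rewrite <- (pow_1 rho); apply Cmod_qpow_le; specialize (H n); rewrite S_INR in H.
    pose proof (pos_INR n); simpl; lra.
Qed.

Lemma omq_prod_bounds (m : nat -> R) : (forall n, INR (S n) <= m (S n))%R ->
  exists c D, (0 < c)%R /\ forall N, (c <= Cmod (cpartprod (fun n => 1 - E (m n))%C N) <= D)%R.
Proof.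
  intros H; pose proof rho_bounds as Hr.
  apply cpartprod_bounds with (A := 1%R) (r := rho) (rho := rho); try lra; intros n.
  - rewrite Rmult_1_l; apply Cmod_qpow_le; specialize (H n); rewrite S_INR in H; lra.
  - rewrite <- (pow_1 rho); apply Cmod_qpow_le; specialize (H n); rewrite S_INR in H.
    pose proof (pos_INR n); simpl; lra.
Qed.

(** The Pochhammer symbol [(q^7; q^7)_n]; [rqf] is its reciprocal. *)
Let qf : nat -> C := cpartprod (fun n => 1 - E (7 * INR n)).

Let rqf (k : Z) : C := if (k <? 0)%Z then 0 else / qf (Z.to_nat k).

Lemma qf_ge (n : nat) : (INR (S n) <= 7 * INR (S n))%R.
Proof. pose proof (pos_INR (S n)); lra. Qed.

Lemma qf_neq_0 (n : nat) : qf n <> 0.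
Proof.
  destruct (omq_prod_bounds (fun n => 7 * INR n)%R qf_ge) as [c [D [Hc H]]].
  apply Cmod_gt_0; specialize (H n); fold qf in H; lra.
Qed.

Lemma qf_S (n : nat) : qf (S n) = qf n * (1 - E (7 * INR (S n))).
Proof. reflexivity. Qed.

(* With [rqf] vanishing on negative integers this holds for every integer [k],
   so the binomial recursion below needs no boundary cases. *)
Lemma rqf_pred (k : Z) : rqf (k - 1) = (1 - E (7 * IZR k)) * rqf k.
Proof.
  unfold rqf; destruct (Z.ltb_spec (k - 1) 0); destruct (Z.ltb_spec k 0); try lia.
  - ring.
  - replace k with 0%Z by lia; rewrite Rmult_0_r, qpow_0; ring.
  - replace (Z.to_nat k) with (S (Z.to_nat (k - 1))) by lia.
    pose proof (qf_neq_0 (S (Z.to_nat (k - 1)))) as H1; rewrite qf_S in *.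
    replace (INR (S (Z.to_nat (k - 1)))) with (IZR k) in * by (rewrite INR_IZR_INZ; f_equal; lia).
    assert (H2 : 1 - E (7 * IZR k) <> 0) by (intros H2; apply H1; rewrite H2; ring).
    pose proof (qf_neq_0 (Z.to_nat (k - 1))).
    field; auto.
Qed.

Variable e : R.
Hypothesis He : (1 <= e <= 6)%R.

Let phi (j : Z) : R := (7 * (IZR j * (IZR j - 1)) / 2 + e * IZR j)%R.
(** The last factor is the Gaussian binomial coefficient of [2N] over [N + j] in base [q^7]. With
    [z = q^e], [coef N j] is the term in [z^j] of the finite triple product. *)
Let coef (N : nat) (j : Z) : C :=
  zsgn j * E (phi j) * (qf (2 * N) * rqf (Z.of_nat N + j) * rqf (Z.of_nat N - j)).

(** Passing from [N] to [N + 1] multiplies the product by [(1 - z q^(7N)) (1 - z^(-1) q^(7N+7))],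
    where [z = q^e]. The recursion compares the terms in [z^j], as if [z] were a free variable. *)
Lemma triple_coef_rec (N : nat) (j : Z) :
  coef (S N) j = (1 + E (14 * INR N + 7)) * coef N j
    + (- E (7 * INR N + e)) * coef N (j - 1)%Z + (- E (7 * INR N + 7 - e)) * coef N (j + 1)%Z.
Proof.
  unfold coef; rewrite zsgn_succ, zsgn_pred.
  replace (Z.of_nat N + j)%Z with ((Z.of_nat (S N) + j) - 1)%Z by lia.
  replace (Z.of_nat N - j)%Z with ((Z.of_nat (S N) - j) - 1)%Z by lia.
  replace (Z.of_nat N + (j - 1))%Z with ((Z.of_nat (S N) + j) - 1 - 1)%Z by lia.
  replace (Z.of_nat N - (j - 1))%Z with (Z.of_nat (S N) - j)%Z by lia.
  replace (Z.of_nat N + (j + 1))%Z with (Z.of_nat (S N) + j)%Z by lia.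
  replace (Z.of_nat N - (j + 1))%Z with ((Z.of_nat (S N) - j) - 1 - 1)%Z by lia.
  rewrite !rqf_pred.
  set (R1 := rqf _); set (T1 := rqf _).
  (* In terms of [X], [Y], [E 7] and the common factors, the recursion becomes a polynomial
     identity; [E1] to [E9] perform the translation. *)
  set (X := E (7 * (INR N + IZR j))); set (Y := E (7 * (INR N - IZR j))).
  replace (2 * S N)%nat with (S (S (2 * N))) by lia.
  rewrite !qf_S.
  assert (E1 : E (7 * INR (S (2 * N))) = E 7 * X * Y).
  { unfold X, Y; rewrite <- !qpow_plus; f_equal; rewrite S_INR, mult_INR; simpl; ring. }
  assert (E2 : E (7 * INR (S (S (2 * N)))) = E 7 * E 7 * X * Y).
  { unfold X, Y; rewrite <- !qpow_plus; f_equal; rewrite !S_INR, mult_INR; simpl; ring. }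
  assert (E3 : E (14 * INR N + 7) = E 7 * X * Y).
  { unfold X, Y; rewrite <- !qpow_plus; f_equal; ring. }
  assert (E4 : E (7 * INR N + e) * E (phi (j - 1)) = E 7 * Y * E (phi j)).
  { unfold Y, phi; rewrite <- !qpow_plus; f_equal; rewrite minus_IZR; field. }
  assert (E5 : E (7 * INR N + 7 - e) * E (phi (j + 1)) = E 7 * X * E (phi j)).
  { unfold X, phi; rewrite <- !qpow_plus; f_equal; rewrite plus_IZR; field. }
  assert (E6 : E (7 * IZR (Z.of_nat (S N) + j)) = E 7 * X).
  { unfold X; rewrite <- !qpow_plus; f_equal; rewrite plus_IZR, <- INR_IZR_INZ, S_INR; ring. }
  assert (E7 : E (7 * IZR (Z.of_nat (S N) + j - 1)) = X).
  { unfold X; f_equal; rewrite minus_IZR, plus_IZR, <- INR_IZR_INZ, S_INR; ring. }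
  assert (E8 : E (7 * IZR (Z.of_nat (S N) - j)) = E 7 * Y).
  { unfold Y; rewrite <- !qpow_plus; f_equal; rewrite minus_IZR, <- INR_IZR_INZ, S_INR; ring. }
  assert (E9 : E (7 * IZR (Z.of_nat (S N) - j - 1)) = Y).
  { unfold Y; f_equal; rewrite !minus_IZR, <- INR_IZR_INZ, S_INR; ring. }
  rewrite E1, E2, E3, E6, E7, E8, E9.
  replace (- E (7 * INR N + e) * (- zsgn j * E (phi (j - 1)) *
     (qf (2 * N) * ((1 - X) * ((1 - E 7 * X) * R1)) * T1)))
    with ((E (7 * INR N + e) * E (phi (j - 1))) * (zsgn j *
     (qf (2 * N) * ((1 - X) * ((1 - E 7 * X) * R1)) * T1))) by ring.
  replace (- E (7 * INR N + 7 - e) * (- zsgn j * E (phi (j + 1)) *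
     (qf (2 * N) * R1 * ((1 - Y) * ((1 - E 7 * Y) * T1)))))
    with ((E (7 * INR N + 7 - e) * E (phi (j + 1))) * (zsgn j *
     (qf (2 * N) * R1 * ((1 - Y) * ((1 - E 7 * Y) * T1))))) by ring.
  rewrite E4, E5; ring.
Qed.

Lemma triple_coef_zero (N : nat) (j : Z) : (Z.of_nat N < Z.abs j)%Z -> coef N j = 0.
Proof.
  intros H; unfold coef, rqf.
  destruct (Z.ltb_spec (Z.of_nat N + j) 0); destruct (Z.ltb_spec (Z.of_nat N - j) 0);
    try lia; ring.
Qed.

Let prodfac (n : nat) : C := (1 - E (7 * INR n - e)) * (1 - E (7 * INR n - (7 - e))).

(** MacMahon's finite form of the triple product. The window [[-N - 1, N]] contains the support
    [|j| <= N] of [coef N], so the boundary terms created by shifting the index vanish. *)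
Lemma finite_triple_product (N : nat) : cpartprod prodfac N = zsum (coef N) (S N).
Proof.
  induction N as [|N IH].
  - rewrite zsum_S, (triple_coef_zero 0 (- Z.of_nat 0 - 1)) by (simpl; lia).
    unfold zsum, coef, rqf, qf, phi; simpl.
    replace (7 * (0 * (0 - 1)) / 2 + e * 0)%R with 0%R by field.
    rewrite qpow_0; unfold zsgn; simpl; field.
  - simpl cpartprod; rewrite IH.
    rewrite (zsum_ext _ _ (S (S N)) (triple_coef_rec N)), !zsum_plus, !zsum_scal.
    rewrite zsum_shift, zsum_shift_back, (zsum_S (coef N) (S N)).
    rewrite (triple_coef_zero N (Z.of_nat (S N))) by lia.
    rewrite (triple_coef_zero N (- Z.of_nat (S N) - 1)) by lia.
    rewrite (triple_coef_zero N (- Z.of_nat (S (S N)) - 1)) by lia.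
    rewrite (triple_coef_zero N (Z.of_nat (S (S N)) - 1)) by lia.
    rewrite (triple_coef_zero N (- Z.of_nat (S (S N)))) by lia.
    rewrite (triple_coef_zero N (Z.of_nat (S (S N)))) by lia.
    unfold prodfac; rewrite S_INR.
    replace (7 * (INR N + 1) - e)%R with (7 * INR N + 7 - e)%R by ring.
    replace (7 * (INR N + 1) - (7 - e))%R with (7 * INR N + e)%R by ring.
    replace (14 * INR N + 7)%R with ((7 * INR N + 7 - e) + (7 * INR N + e))%R by ring.
    rewrite (qpow_plus (7 * INR N + 7 - e) (7 * INR N + e)).
    generalize (zsum (coef N) (S N)), (E (7 * INR N + 7 - e)), (E (7 * INR N + e)). intros; ring.
Qed.

(** Together with the next bound: since [1 <= e <= 6], the exponent grows at least linearly in both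
    directions, so [rho^n] dominates both halves of the series. *)
Lemma phi_nonneg_index (n : nat) : (INR n <= phi (Z.of_nat n))%R.
Proof.
  unfold phi; rewrite <- INR_IZR_INZ; pose proof (pos_INR n).
  assert (0 <= INR n * (INR n - 1))%R.
  { destruct n; [simpl; lra|]; rewrite S_INR; pose proof (pos_INR n).
    apply Rmult_le_pos; lra. }
  nra.
Qed.

Lemma phi_neg_index (n : nat) : (INR n <= phi (- Z.of_nat n - 1))%R.
Proof.
  unfold phi; rewrite minus_IZR, opp_IZR, <- INR_IZR_INZ; pose proof (pos_INR n); nra.
Qed.

Lemma theta_series_limit :
  exists S, Ccv (zsum (fun j => zsgn j * E (phi j))) S.
Proof.
  pose proof rho_bounds as Hr.
  destruct (csum_limit (fun n => zsgn (Z.of_nat n) * E (phi (Z.of_nat n))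
     + zsgn (- Z.of_nat n - 1) * E (phi (- Z.of_nat n - 1)%Z)) 2 rho ltac:(lra)) as [S HS].
  - intros n; eapply Rle_trans; [apply Cmod_triangle|].
    rewrite !Cmod_mult, !Cmod_zsgn, !Rmult_1_l.
    pose proof (Cmod_qpow_le _ n (phi_nonneg_index n)).
    pose proof (Cmod_qpow_le _ n (phi_neg_index n)); lra.
  - exists S; eapply Ccv_geom_rate; [|exact HS]; lra.
Qed.

(** Limit of the finite form. The Gaussian binomial tends to [L / (L * L) = 1 / L] for fixed [j],
    and is bounded by [D / c^2] for all [N] and [j], where [c] and [D] enclose the moduli of [qf];
    this is the majorant for Tannery's theorem. *)
Lemma triple_product (L S : C) :
  L <> 0 -> Ccv qf L -> Ccv (zsum (fun j => zsgn j * E (phi j))) S -> Ccv (cpartprod prodfac) (S / L).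
Proof.
  intros HL Hq HS; pose proof rho_bounds as Hr.
  destruct (omq_prod_bounds (fun n => 7 * INR n)%R qf_ge) as [c [D [Hc HB]]]; fold qf in HB.
  apply Ccv_ext with (fun N => zsum (coef N) (Datatypes.S N)).
  { intros N; symmetry; apply finite_triple_product. }
  assert (Hrq : forall k, (Cmod (rqf k) <= / c)%R).
  { intros k; unfold rqf; destruct (Z.ltb_spec k 0).
    - rewrite Cmod_0; apply Rlt_le, Rinv_0_lt_compat, Hc.
    - rewrite Cmod_inv by apply qf_neq_0; apply Rinv_le_contravar; [exact Hc|apply HB]. }
  assert (Hco : forall N j, (Cmod (coef N j) <= D * / c * / c * Cmod (E (phi j)))%R).
  { intros N j; unfold coef; rewrite !Cmod_mult, Cmod_zsgn, Rmult_1_l, Rmult_comm.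
    apply Rmult_le_compat_r; [apply Cmod_ge_0|].
    apply Rmult_le_compat; [|apply Cmod_ge_0| |apply Hrq].
    - apply Rmult_le_pos; apply Cmod_ge_0.
    - apply Rmult_le_compat; [apply Cmod_ge_0|apply Cmod_ge_0|apply HB|apply Hrq]. }
  assert (HD : (0 <= D * / c * / c)%R).
  { specialize (HB O); assert (0 < / c)%R by (apply Rinv_0_lt_compat; exact Hc).
    apply Rmult_le_pos; [apply Rmult_le_pos|]; lra. }
  assert (Hlim : forall j, Ccv (fun N => coef N j) (/ L * (zsgn j * E (phi j)))).
  { intros j.
    (* After discarding [|j|] initial terms the index is nonnegative, so the zero branch of [rqf] no
       longer occurs. *)
    assert (Hr1 : forall (k : nat -> Z), (forall N, Z.of_nat N - Z.abs j <= k N)%Z ->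
      Ccv (fun N => rqf (k N)) (/ L)).
    { intros k Hk; apply Ccv_incr with (k := Z.to_nat (Z.abs j)).
      apply Ccv_ext with (fun N => / qf (Z.to_nat (k (N + Z.to_nat (Z.abs j))%nat))).
      - intros N; unfold rqf; specialize (Hk (N + Z.to_nat (Z.abs j))%nat).
        destruct (Z.ltb_spec (k (N + Z.to_nat (Z.abs j))%nat) 0); [lia|reflexivity].
      - apply Ccv_inv; [exact HL|].
        apply (Ccv_subseq qf L (fun N => Z.to_nat (k (N + Z.to_nat (Z.abs j))%nat))); [|exact Hq].
        intros N; specialize (Hk (N + Z.to_nat (Z.abs j))%nat); lia. }
    replace (/ L * (zsgn j * E (phi j))) with (zsgn j * E (phi j) * (L * / L * / L)) by (field; auto).
    apply Ccv_scal, Ccv_mult; [apply Ccv_mult|]; [|apply Hr1; intros; lia|apply Hr1; intros; lia].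
    apply (Ccv_subseq qf L (fun N => 2 * N)%nat); [intros; lia|exact Hq]. }
  apply csum_tannery with (A := (2 * (D * / c * / c))%R) (r := rho)
    (q := fun n => / L * (zsgn (Z.of_nat n) * E (phi (Z.of_nat n)))
      + / L * (zsgn (- Z.of_nat n - 1) * E (phi (- Z.of_nat n - 1)%Z))); [lra| | | |intros; lia].
  - intros N n; eapply Rle_trans; [apply Cmod_triangle|].
    pose proof (Hco N (Z.of_nat n)); pose proof (Hco N (- Z.of_nat n - 1)%Z).
    pose proof (Rmult_le_compat_l _ _ _ HD (Cmod_qpow_le _ n (phi_nonneg_index n))).
    pose proof (Rmult_le_compat_l _ _ _ HD (Cmod_qpow_le _ n (phi_neg_index n))); lra.
  - intros n; apply Ccv_plus; apply Hlim.
  - replace (S / L) with (/ L * S) by (field; auto).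
    apply Ccv_ext with (fun N => / L * zsum (fun j => zsgn j * E (phi j)) N); [|apply Ccv_scal, HS].
    intros N; rewrite <- zsum_scal; reflexivity.
Qed.
End TripleProduct.

(** * [s] and [t] as theta quotients *)

(* The series with [i = 1, 3, 5] are [u, v, w] of the paper. *)
Definition theta_term (tau : C) (i : R) (j : Z) : C :=
  zsgn j * qpow ((14 * IZR j + i) * (14 * IZR j + i) / 56) tau.

Lemma cpartprod_div (f g : nat -> C) (N : nat) :
  (forall n, g (S n) <> 0) ->
  cpartprod (fun n => f n / g n) N = cpartprod f N / cpartprod g N /\ cpartprod g N <> 0.
Proof.
  intros Hg; induction N as [|N [IH1 IH2]].
  - split; [simpl; field|apply C1_nz].
  - simpl; rewrite IH1; split; [field; auto|apply Cmult_neq_0; auto].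
Qed.

Lemma cpartprod_ext (f g : nat -> C) (N : nat) :
  (forall n, f (S n) = g (S n)) -> cpartprod f N = cpartprod g N.
Proof. intros H; induction N as [|N IH]; simpl; [|rewrite IH, H]; reflexivity. Qed.

Lemma cpartprod_mult (f g : nat -> C) (N : nat) :
  cpartprod (fun n => f n * g n) N = cpartprod f N * cpartprod g N.
Proof. induction N as [|N IH]; simpl; [|rewrite IH]; ring. Qed.

Section ThetaQuotients.
Variable tau : C.
Hypothesis Htau : (0 < Im tau)%R.

Let fac (e : R) (n : nat) : C :=
  (1 - qpow (7 * INR n - e) tau) * (1 - qpow (7 * INR n - (7 - e)) tau).

(** With [i = 2e - 7], completing the square gives [(14j + i)^2 / 56 = i^2 / 56 + 7j(j - 1)/2 + ej].
    The constant [K] is returned with its own limit, so that it can be recognised as the same for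
    different [e]. *)
Lemma fac_prod_limit (e : R) : (1 <= e <= 6)%R ->
  exists T : C, Ccv (zsum (theta_term tau (2 * e - 7))) T /\
  exists L K : C, L <> 0 /\ K <> 0 /\ T = K * qpow ((2 * e - 7) * (2 * e - 7) / 56) tau * L
    /\ Ccv (cpartprod (fac e)) L
    /\ Ccv (cpartprod (fun n => 1 - qpow (7 * INR n) tau)) K.
Proof.
  intros He.
  destruct (omq_prod_limit tau Htau (fun n => 7 * INR n)%R) as [K [HK HKl]].
  { intros n; pose proof (pos_INR (S n)); lra. }
  destruct (theta_series_limit tau Htau e He) as [S HS].
  pose proof (triple_product tau Htau e He K S HK HKl HS) as HT.
  assert (Hm : forall d, (1 <= d <= 6)%R -> forall n,
    (INR (Datatypes.S n) <= 7 * INR (Datatypes.S n) - d)%R).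
  { intros d Hd n; rewrite S_INR; pose proof (pos_INR n); lra. }
  destruct (omq_prod_limit tau Htau (fun n => 7 * INR n - e)%R (Hm e He)) as [L1 [HL1 HL1l]].
  destruct (omq_prod_limit tau Htau (fun n => 7 * INR n - (7 - e))%R (Hm (7 - e)%R ltac:(lra)))
    as [L2 [HL2 HL2l]].
  assert (HL : Ccv (cpartprod (fac e)) (L1 * L2)).
  { apply Ccv_ext with (2 := Ccv_mult _ _ _ _ HL1l HL2l); intros N; symmetry; apply cpartprod_mult. }
  assert (Heq : S / K = L1 * L2) by (exact (Ccv_unique _ _ _ HT HL)).
  exists (qpow ((2 * e - 7) * (2 * e - 7) / 56) tau * S); split.
  - apply Ccv_ext with (2 := Ccv_scal _ _ _ HS); intros N.
    rewrite <- zsum_scal; apply zsum_ext; intros j; unfold theta_term.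
    replace ((14 * IZR j + (2 * e - 7)) * (14 * IZR j + (2 * e - 7)) / 56)%R
      with ((2 * e - 7) * (2 * e - 7) / 56 + (7 * (IZR j * (IZR j - 1)) / 2 + e * IZR j))%R by field.
    rewrite (qpow_plus tau ((2 * e - 7) * (2 * e - 7) / 56)%R); ring.
  - exists (L1 * L2), K; repeat split; auto.
    + apply Cmult_neq_0; auto.
    + rewrite <- Heq; field; auto.
Qed.

Lemma fac_neq_0 (e : R) (n : nat) : (1 <= e <= 6)%R -> fac e (S n) <> 0.
Proof.
  intros He; unfold fac.
  assert (H : forall a, (1 <= a)%R -> 1 - qpow a tau <> 0).
  { intros a Ha H0; pose proof (rho_bounds tau Htau) as Hr.
    pose proof (Cmod_qpow_le tau Htau a 1 ltac:(simpl; lra)) as H1.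
    cbv beta in H1; assert (H2 : qpow a tau = 1).
    { replace (qpow a tau) with (1 - (1 - qpow a tau)) by ring; rewrite H0; ring. }
    rewrite H2 in H1.
    rewrite Cmod_1, pow_1 in H1; lra. }
  rewrite S_INR; pose proof (pos_INR n); apply Cmult_neq_0; apply H; lra.
Qed.

Lemma theta_quotients : exists T1 T3 T5 : C,
  Ccv (zsum (theta_term tau 1)) T1 /\ Ccv (zsum (theta_term tau 3)) T3 /\
  Ccv (zsum (theta_term tau 5)) T5 /\ T5 <> 0 /\
  s_fun tau = T1 / T5 /\ t_fun tau = T3 / T5.
Proof.
  (* The values [e = 4, 5, 6] give [i = 2e - 7 = 1, 3, 5]. *)
  destruct (fac_prod_limit 4 ltac:(lra)) as [T1 [HT1 [L1 [K [HL1 [HK [E1 [HP1 HK1]]]]]]]].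
  destruct (fac_prod_limit 5 ltac:(lra)) as [T3 [HT3 [L3 [K3 [HL3 [_ [E3 [HP3 HK3]]]]]]]].
  destruct (fac_prod_limit 6 ltac:(lra)) as [T5 [HT5 [L5 [K5 [HL5 [_ [E5 [HP5 HK5]]]]]]]].
  rewrite (Ccv_unique _ _ _ HK3 HK1) in E3; rewrite (Ccv_unique _ _ _ HK5 HK1) in E5.
  clear K3 K5 HK3 HK5.
  replace (2 * 4 - 7)%R with 1%R in * by ring.
  replace (2 * 5 - 7)%R with 3%R in * by ring.
  replace (2 * 6 - 7)%R with 5%R in * by ring.
  pose proof (qpow_neq_0 tau) as Hq.
  assert (HT5n : T5 <> 0) by (rewrite E5; repeat apply Cmult_neq_0; auto; apply Hq).
  assert (Hfac : forall (e : R) (L : C), (1 <= e <= 6)%R -> Ccv (cpartprod (fac e)) L ->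
    cinfprod (fun n => let k := (7 * INR n)%R in
       Cdiv (Cmult (omq tau (k - (7 - e))%R) (omq tau (k - e)%R))
            (Cmult (omq tau (k - 1)%R) (omq tau (k - 6)%R))) = L / L5).
  { intros e L He HL; apply cinfprod_eq.
    apply Ccv_ext with (2 := Ccv_div _ _ _ _ HL5 HL HP5); intros N.
    symmetry; rewrite <- (proj1 (cpartprod_div (fac e) (fac 6) N ltac:(intros; apply fac_neq_0; lra))).
    apply cpartprod_ext; intros n; unfold fac, omq; cbv zeta.
    replace (7 - 6)%R with 1%R by ring; f_equal; ring. }
  exists T1, T3, T5; repeat split; auto.
  - transitivity (qpow (-3 / 7) tau * (L1 / L5)).
    { unfold s_fun; apply f_equal. replace 3%R with (7 - 4)%R by ring. apply Hfac; [lra|exact HP1]. }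
    rewrite E1, E5.
    (* The prefactor of [s] is the quotient of the leading powers: [1/56 - 25/56 = -3/7]. For [t] it
       is [9/56 - 25/56 = -2/7]. *)
    replace (1 * 1 / 56)%R with (-3 / 7 + 5 * 5 / 56)%R by field.
    rewrite (qpow_plus tau); field; repeat split; auto; apply Hq.
  - transitivity (qpow (-2 / 7) tau * (L3 / L5)).
    { unfold t_fun; apply f_equal. replace 2%R with (7 - 5)%R by ring. apply Hfac; [lra|exact HP3]. }
    rewrite E3, E5.
    replace (3 * 3 / 56)%R with (-2 / 7 + 5 * 5 / 56)%R by field.
    rewrite (qpow_plus tau); field; repeat split; auto; apply Hq.
Qed.
End ThetaQuotients.

(** * Uniqueness of Fourier coefficients *)

Open Scope R_scope.

Lemma continuous_of_derive (f : R -> R) (x : R) : ex_derive f x -> continuous f x.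
Proof. apply (ex_derive_continuous f x). Qed.

Lemma ex_RInt_continuous_le (f : R -> R) (a b : R) : a <= b ->
  (forall x, a <= x <= b -> continuous f x) -> ex_RInt f a b.
Proof.
  intros Hab H; apply (ex_RInt_continuous (V := R_CompleteNormedModule)); intros x Hx; apply H.
  rewrite Rmin_left, Rmax_right in Hx; lra.
Qed.

Lemma RInt_Rplus (f g : R -> R) (a b : R) : ex_RInt f a b -> ex_RInt g a b ->
  RInt (fun x => f x + g x) a b = RInt f a b + RInt g a b.
Proof. exact (RInt_plus f g a b). Qed.

Lemma RInt_Rscal (f : R -> R) (a b k : R) : ex_RInt f a b ->
  RInt (fun x => k * f x) a b = k * RInt f a b.
Proof. exact (RInt_scal f a b k). Qed.

Lemma ex_RInt_Rplus (f g : R -> R) (a b : R) : ex_RInt f a b -> ex_RInt g a b ->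
  ex_RInt (fun x => f x + g x) a b.
Proof. exact (ex_RInt_plus f g a b). Qed.

Lemma ex_RInt_Rscal (f : R -> R) (a b k : R) : ex_RInt f a b ->
  ex_RInt (fun x => k * f x) a b.
Proof. exact (ex_RInt_scal f a b k). Qed.

Lemma RInt_ge_const (f : R -> R) (a b c : R) : a <= b -> ex_RInt f a b ->
  (forall x, a < x < b -> c <= f x) -> (b - a) * c <= RInt f a b.
Proof.
  intros Hab Hf H; replace ((b - a) * c) with (RInt (fun _ => c) a b)
    by (rewrite RInt_const; reflexivity).
  apply RInt_le; auto; apply ex_RInt_const.
Qed.

Lemma cos_le_outside (y d : R) : 0 <= d <= PI -> d <= y <= 2 * PI - d -> cos y <= cos d.
Proof.
  intros Hd Hy; destruct (Rle_dec y PI).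
  - apply cos_decr_1; lra.
  - replace (cos y) with (cos (2 * PI - y)).
    + apply cos_decr_1; lra.
    + replace (2 * PI - y) with (- y + 2 * 1 * PI) by ring.
      replace 1 with (INR 1) by reflexivity; rewrite cos_period; apply cos_neg.
Qed.

Lemma cos_Rabs (y : R) : cos (Rabs y) = cos y.
Proof. unfold Rabs; destruct (Rcase_abs y); [apply cos_neg|reflexivity]. Qed.

Section FourierUniqueness.
Variable H : R -> R.
Hypothesis Hcont : forall x, 0 <= x <= 1 -> continuous H x.
Hypothesis Hcos : forall k : Z, RInt (fun x => H x * cos (2 * PI * IZR k * x)) 0 1 = 0.
Hypothesis Hsin : forall k : Z, RInt (fun x => H x * sin (2 * PI * IZR k * x)) 0 1 = 0.

Lemma ex_RInt_mult_smooth (g : R -> R) (a b : R) : 0 <= a -> a <= b -> b <= 1 ->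
  (forall x, ex_derive g x) -> ex_RInt (fun x => H x * g x) a b.
Proof.
  intros Ha Hab Hb Hg; apply ex_RInt_continuous_le; [exact Hab|]; intros x Hx.
  apply (continuous_mult H g); [apply Hcont; lra|apply continuous_of_derive, Hg].
Qed.

(** The extra cosine lets the induction on [n] close: the product-to-sum formula turns one more
    factor into the frequencies [k], [k + 1] and [k - 1]. The application has [k = 0]. *)
Lemma trig_poly_orthogonal (x0 c : R) (n : nat) : forall k : Z,
  RInt (fun x => H x * ((c + cos (2 * PI * (x - x0))) ^ n * cos (2 * PI * IZR k * (x - x0)))) 0 1 = 0.
Proof.
  induction n as [|n IH]; intros k.
  - rewrite RInt_ext with (g := fun x =>
      cos (2 * PI * IZR k * x0) * (H x * cos (2 * PI * IZR k * x))
      + sin (2 * PI * IZR k * x0) * (H x * sin (2 * PI * IZR k * x))).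
    + assert (Hc : ex_RInt (fun x => H x * cos (2 * PI * IZR k * x)) 0 1)
        by (apply ex_RInt_mult_smooth; try lra; intros; auto_derive; trivial).
      assert (Hs : ex_RInt (fun x => H x * sin (2 * PI * IZR k * x)) 0 1)
        by (apply ex_RInt_mult_smooth; try lra; intros; auto_derive; trivial).
      rewrite (RInt_Rplus _ _ _ _ (ex_RInt_Rscal _ _ _ _ Hc) (ex_RInt_Rscal _ _ _ _ Hs)).
      rewrite (RInt_Rscal _ _ _ _ Hc), (RInt_Rscal _ _ _ _ Hs), Hcos, Hsin.
      rewrite !Rmult_0_r; apply Rplus_0_r.
    + intros x _.
      replace (2 * PI * IZR k * (x - x0)) with (2 * PI * IZR k * x - 2 * PI * IZR k * x0) by ring.
      rewrite cos_minus; simpl; ring.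
  - set (T := fun j x => H x * ((c + cos (2 * PI * (x - x0))) ^ n * cos (2 * PI * IZR j * (x - x0)))).
    assert (He : forall j, ex_RInt (T j) 0 1).
    { intros j; apply ex_RInt_mult_smooth; try lra; intros; auto_derive; trivial. }
    rewrite RInt_ext with (g := fun x => c * T k x + (/ 2 * T (k + 1)%Z x + / 2 * T (k - 1)%Z x)).
    + pose proof (fun j k => ex_RInt_Rscal _ _ _ k (He j)) as Hs.
      rewrite (RInt_Rplus _ _ _ _ (Hs k c) (ex_RInt_Rplus _ _ _ _ (Hs _ _) (Hs _ _))).
      rewrite (RInt_Rplus _ _ _ _ (Hs _ _) (Hs _ _)), !(fun j k => RInt_Rscal _ _ _ k (He j)).
      assert (H0 : forall j, RInt (T j) 0 1 = 0) by (intros j; apply IH).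
      rewrite !H0, !Rmult_0_r, !Rplus_0_r; reflexivity.
    + intros x _; unfold T; rewrite plus_IZR, minus_IZR.
      replace (2 * PI * (IZR k + 1) * (x - x0))
        with (2 * PI * IZR k * (x - x0) + 2 * PI * (x - x0)) by ring.
      replace (2 * PI * (IZR k - 1) * (x - x0))
        with (2 * PI * IZR k * (x - x0) - 2 * PI * (x - x0)) by ring.
      rewrite cos_plus, cos_minus; simpl; field.
Qed.

(* The trigonometric polynomial [1 + cos (2 pi (x - x0)) - cos (2 pi d)] exceeds 1 exactly
   near [x0], so its powers would make the integral against [H] blow up if [H x0 > 0]. *)
Lemma fourier_unique_nonpos (x0 : R) : 0 < x0 < 1 -> H x0 <= 0.
Proof.
  intros Hx0; destruct (Rle_lt_dec (H x0) 0) as [|Hpos]; [assumption|exfalso].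
  pose proof PI_RGT_0 as Hpi.
  assert (HB : exists B, forall x, 0 <= x <= 1 -> - B <= H x <= B).
  { destruct (continuity_ab_maj H 0 1) as [M [HM _]]; [lra| |].
    { intros x Hx; apply continuity_pt_filterlim, Hcont, Hx. }
    destruct (continuity_ab_min H 0 1) as [m [Hm _]]; [lra| |].
    { intros x Hx; apply continuity_pt_filterlim, Hcont, Hx. }
    exists (Rabs (H M) + Rabs (H m)); intros x Hx.
    specialize (HM x Hx); specialize (Hm x Hx).
    pose proof (Rle_abs (H M)); pose proof (Rle_abs (- H m)); rewrite Rabs_Ropp in *.
    pose proof (Rabs_pos (H M)); pose proof (Rabs_pos (H m)); lra. }
  destruct HB as [B HB].
  assert (Hd : exists d, 0 < d /\ d <= x0 /\ d <= 1 - x0 /\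
    forall x, Rabs (x - x0) < d -> H x0 / 2 <= H x).
  { assert (Hc := Hcont x0 ltac:(lra)).
    assert (Hm : 0 < H x0 / 2) by lra.
    destruct (proj1 (filterlim_locally _ _) Hc (mkposreal _ Hm)) as [e He].
    exists (Rmin e (Rmin x0 (1 - x0))); repeat split.
    - repeat apply Rmin_glb_lt; try lra; apply cond_pos.
    - eapply Rle_trans; [apply Rmin_r|apply Rmin_l].
    - eapply Rle_trans; [apply Rmin_r|apply Rmin_r].
    - intros x Hx; specialize (He x).
      assert (Hb : ball x0 e x).
      { change (Rabs (x - x0) < e); eapply Rlt_le_trans; [exact Hx|apply Rmin_l]. }
      specialize (He Hb); change (Rabs (H x - H x0) < H x0 / 2) in He.
      apply Rabs_def2 in He; lra. }
  destruct Hd as [d [Hd0 [Hd1 [Hd2 Hd]]]].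
  (* [p] equals 1 at distance [d] from [x0] and [kap > 1] at distance [d / 2]. Since [d <= x0] and
     [d <= 1 - x0], points of [[0, 1]] farther away than [d] stay within distance [1 - d], where [p]
     lies in [[-1, 1]]. *)
  set (c := 1 - cos (2 * PI * d)); set (kap := c + cos (PI * d)).
  set (p := fun x => c + cos (2 * PI * (x - x0))).
  assert (Hkap : 1 < kap).
  { unfold kap, c; assert (cos (2 * PI * d) < cos (PI * d)); [|lra].
    apply cos_decreasing_1; nra. }
  pose proof (COS_bound (2 * PI * d)) as Hcd.
  assert (Hin : forall x, Rabs (x - x0) <= d / 2 -> kap <= p x).
  { intros x Hx; unfold kap, p; apply Rplus_le_compat_l; rewrite <- (cos_Rabs (2 * PI * (x - x0))).
    rewrite Rabs_mult, (Rabs_pos_eq (2 * PI)) by lra.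
    pose proof (Rabs_pos (x - x0)); apply cos_decr_1; nra. }
  assert (Hmid : forall x, Rabs (x - x0) <= d -> 1 <= p x).
  { intros x Hx; unfold p, c; rewrite <- (cos_Rabs (2 * PI * (x - x0))).
    rewrite Rabs_mult, (Rabs_pos_eq (2 * PI)) by lra.
    pose proof (Rabs_pos (x - x0)).
    assert (cos (2 * PI * d) <= cos (2 * PI * Rabs (x - x0))); [apply cos_decr_1; nra|lra]. }
  assert (Hout : forall x, 0 <= x <= 1 -> d <= Rabs (x - x0) -> -1 <= p x <= 1).
  { intros x Hx Hdx; unfold p, c; rewrite <- (cos_Rabs (2 * PI * (x - x0))).
    rewrite Rabs_mult, (Rabs_pos_eq (2 * PI)) by lra.
    assert (Rabs (x - x0) <= 1 - d) by (apply Rabs_le; lra).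
    pose proof (COS_bound (2 * PI * Rabs (x - x0))).
    assert (cos (2 * PI * Rabs (x - x0)) <= cos (2 * PI * d)); [apply cos_le_outside; nra|lra]. }
  assert (HB0 : 0 <= B) by (specialize (HB x0 ltac:(lra)); lra).
  assert (Hlow : forall n x, 0 <= x <= 1 -> - B <= H x * p x ^ n).
  { intros n x Hx; destruct (Rle_lt_dec d (Rabs (x - x0))) as [Hf|Hn].
    - assert (Hp : Rabs (p x ^ n) <= 1).
      { rewrite <- RPow_abs, <- (pow1 n); apply pow_incr; split; [apply Rabs_pos|].
        apply Rabs_le, Hout; assumption. }
      assert (Habs : Rabs (H x * p x ^ n) <= B).
      { rewrite Rabs_mult, <- (Rmult_1_r B).
        apply Rmult_le_compat; try apply Rabs_pos; [apply Rabs_le, HB, Hx|exact Hp]. }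
      apply Rabs_le_between in Habs; lra.
    - apply Rle_trans with 0; [lra|]; apply Rmult_le_pos; [specialize (Hd x Hn); lra|].
      apply pow_le; specialize (Hmid x (Rlt_le _ _ Hn)); lra. }
  assert (Hhigh : forall n x, x0 - d / 2 < x < x0 + d / 2 -> H x0 / 2 * kap ^ n <= H x * p x ^ n).
  { intros n x Hx; assert (Hab : Rabs (x - x0) <= d / 2) by (apply Rabs_le; lra).
    apply Rmult_le_compat; [lra|apply pow_le; lra|apply Hd; lra|].
    apply pow_incr; split; [lra|apply Hin, Hab]. }
  (* The integral of [H * p^n] vanishes, while the middle interval of length [d] contributes at
     least [d * (H x0 / 2) * kap^n] and the two outer ones together at least [- B]. Growth of
     [kap^n] then gives the contradiction. *)
  assert (Hineq : forall n, d * (H x0 / 2 * kap ^ n) <= B).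
  { intros n; pose proof (trig_poly_orthogonal x0 c n 0) as H0.
    rewrite RInt_ext with (g := fun x => H x * p x ^ n) in H0.
    2:{ intros x _; unfold p; rewrite Rmult_0_r, Rmult_0_l, cos_0, Rmult_1_r; reflexivity. }
    assert (He : forall a b, 0 <= a -> a <= b -> b <= 1 -> ex_RInt (fun x => H x * p x ^ n) a b).
    { intros a b Ha Hab Hb; apply ex_RInt_mult_smooth; try lra.
      intros; unfold p; auto_derive; trivial. }
    rewrite <- (RInt_Chasles (V := R_CompleteNormedModule) _ 0 (x0 - d / 2) 1) in H0
      by (apply He; lra).
    rewrite <- (RInt_Chasles (V := R_CompleteNormedModule) _ (x0 - d / 2) (x0 + d / 2) 1) in H0
      by (apply He; lra).
    change plus with Rplus in H0; simpl in H0.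
    pose proof (RInt_ge_const (fun x => H x * p x ^ n) 0 (x0 - d / 2) (- B) ltac:(lra)
      ltac:(apply He; lra) ltac:(intros; apply Hlow; lra)).
    pose proof (RInt_ge_const (fun x => H x * p x ^ n) (x0 + d / 2) 1 (- B) ltac:(lra)
      ltac:(apply He; lra) ltac:(intros; apply Hlow; lra)).
    pose proof (RInt_ge_const (fun x => H x * p x ^ n) (x0 - d / 2) (x0 + d / 2) _ ltac:(lra)
      ltac:(apply He; lra) (Hhigh n)).
    replace (x0 + d / 2 - (x0 - d / 2)) with d in * by field.
    nra. }
  destruct (Pow_x_infinity kap) with (b := (2 * (B + 1) / (d * H x0))) as [N HN].
  { rewrite Rabs_pos_eq; lra. }
  specialize (HN N (le_n N)); rewrite Rabs_pos_eq in HN by (apply pow_le; lra).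
  specialize (Hineq N).
  assert (HdH : 0 < d * H x0) by (apply Rmult_lt_0_compat; lra).
  apply Rge_le in HN; apply Rmult_le_compat_l with (r := d * H x0) in HN; [|lra].
  replace (d * H x0 * (2 * (B + 1) / (d * H x0))) with (2 * (B + 1)) in HN by (field; lra).
  lra.
Qed.
End FourierUniqueness.

Lemma fourier_unique (H : R -> R) :
  (forall x, 0 <= x <= 1 -> continuous H x) ->
  (forall k : Z, RInt (fun x => H x * cos (2 * PI * IZR k * x)) 0 1 = 0) ->
  (forall k : Z, RInt (fun x => H x * sin (2 * PI * IZR k * x)) 0 1 = 0) ->
  forall x0, 0 < x0 < 1 -> H x0 = 0.
Proof.
  intros Hcont Hcos Hsin x0 Hx0.
  assert (Hopp : forall g : R -> R, (forall x, ex_derive g x) ->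
    RInt (fun x => H x * g x) 0 1 = 0 -> RInt (fun x => - H x * g x) 0 1 = 0).
  { intros g Hg Hi; rewrite RInt_ext with (g := fun x => -1 * (H x * g x))
      by (intros; simpl; ring).
    rewrite RInt_Rscal, Hi; [apply Rmult_0_r|apply (ex_RInt_mult_smooth H Hcont); auto; lra]. }
  pose proof (fourier_unique_nonpos H Hcont Hcos Hsin x0 Hx0).
  pose proof (fourier_unique_nonpos (fun x => - H x)
    ltac:(intros x Hx; apply (continuous_opp H), Hcont, Hx)
    ltac:(intros k; apply (Hopp (fun x => cos (2 * PI * IZR k * x)));
      [intros; auto_derive; trivial|apply Hcos])
    ltac:(intros k; apply (Hopp (fun x => sin (2 * PI * IZR k * x)));
      [intros; auto_derive; trivial|apply Hsin])
    x0 Hx0).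
  lra.
Qed.

Open Scope C_scope.

(** * Integrals of complex-valued functions *)

Definition Ccont (f : R -> C) (x : R) : Prop :=
  continuous (fun y => fst (f y)) x /\ continuous (fun y => snd (f y)) x.

Definition CInt (f : R -> C) (a b : R) : C :=
  (RInt (fun x => fst (f x)) a b, RInt (fun x => snd (f x)) a b).

Lemma Ccont_const (c : C) (x : R) : Ccont (fun _ => c) x.
Proof. split; apply continuous_const. Qed.

Lemma Ccont_plus (f g : R -> C) (x : R) :
  Ccont f x -> Ccont g x -> Ccont (fun y => f y + g y) x.
Proof.
  intros [Hf1 Hf2] [Hg1 Hg2]; split;
    [exact (continuous_plus _ _ _ Hf1 Hg1)|exact (continuous_plus _ _ _ Hf2 Hg2)].
Qed.

Lemma Ccont_mult (f g : R -> C) (x : R) :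
  Ccont f x -> Ccont g x -> Ccont (fun y => f y * g y) x.
Proof.
  intros [Hf1 Hf2] [Hg1 Hg2]; split.
  - exact (continuous_minus _ _ _ (continuous_mult _ _ _ Hf1 Hg1) (continuous_mult _ _ _ Hf2 Hg2)).
  - exact (continuous_plus _ _ _ (continuous_mult _ _ _ Hf1 Hg2) (continuous_mult _ _ _ Hf2 Hg1)).
Qed.

Lemma Ccont_csum (p : nat -> R -> C) (N : nat) (x : R) :
  (forall n, Ccont (p n) x) -> Ccont (fun y => csum (fun n => p n y) N) x.
Proof.
  intros H; induction N as [|N IH]; [apply Ccont_const|].
  exact (Ccont_plus _ _ _ IH (H N)).
Qed.

Lemma Ccont_zsum (p : Z -> R -> C) (N : nat) (x : R) :
  (forall n, Ccont (p n) x) -> Ccont (fun y => zsum (fun n => p n y) N) x.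
Proof. intros H; apply (Ccont_csum (fun n y => _)); intros n; apply Ccont_plus; apply H. Qed.

Lemma ex_RInt_Ccont (f : R -> C) (a b : R) : (a <= b)%R ->
  (forall x, (a <= x <= b)%R -> Ccont f x) ->
  ex_RInt (fun x => fst (f x)) a b /\ ex_RInt (fun x => snd (f x)) a b.
Proof.
  intros Hab H; split; apply ex_RInt_continuous_le; auto; intros x Hx; apply (H x Hx).
Qed.

Lemma CInt_ext (f g : R -> C) (a b : R) : (forall x, f x = g x) -> CInt f a b = CInt g a b.
Proof. intros H; unfold CInt; f_equal; apply RInt_ext; intros x _; rewrite H; reflexivity. Qed.

Lemma CInt_plus (f g : R -> C) (a b : R) : (a <= b)%R ->
  (forall x, (a <= x <= b)%R -> Ccont f x) -> (forall x, (a <= x <= b)%R -> Ccont g x) ->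
  CInt (fun x => f x + g x) a b = CInt f a b + CInt g a b.
Proof.
  intros Hab Hf Hg.
  destruct (ex_RInt_Ccont f a b Hab Hf), (ex_RInt_Ccont g a b Hab Hg).
  apply C_eq; simpl; apply RInt_Rplus; assumption.
Qed.

Lemma CInt_scal (c : C) (f : R -> C) (a b : R) : (a <= b)%R ->
  (forall x, (a <= x <= b)%R -> Ccont f x) ->
  CInt (fun x => c * f x) a b = c * CInt f a b.
Proof.
  intros Hab Hf; destruct (ex_RInt_Ccont f a b Hab Hf) as [H1 H2].
  apply C_eq; simpl.
  - transitivity (RInt (fun x => fst c * fst (f x) + - snd c * snd (f x))%R a b).
    { apply RInt_ext; intros x _; simpl; ring. }
    rewrite (RInt_Rplus _ _ _ _ (ex_RInt_Rscal _ _ _ _ H1) (ex_RInt_Rscal _ _ _ _ H2)).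
    rewrite (RInt_Rscal _ _ _ _ H1), (RInt_Rscal _ _ _ _ H2); simpl; ring.
  - rewrite (RInt_Rplus _ _ _ _ (ex_RInt_Rscal _ _ _ _ H2) (ex_RInt_Rscal _ _ _ _ H1)).
    rewrite (RInt_Rscal _ _ _ _ H1), (RInt_Rscal _ _ _ _ H2); reflexivity.
Qed.

Lemma CInt_Chasles (f : R -> C) (a b c : R) : (a <= b)%R -> (b <= c)%R ->
  (forall x, Ccont f x) -> CInt f a b + CInt f b c = CInt f a c.
Proof.
  intros Hab Hbc Hf.
  destruct (ex_RInt_Ccont f a b Hab (fun x _ => Hf x)) as [H1 H2].
  destruct (ex_RInt_Ccont f b c Hbc (fun x _ => Hf x)) as [H3 H4].
  apply C_eq; simpl; [exact (RInt_Chasles _ a b c H1 H3)|exact (RInt_Chasles _ a b c H2 H4)].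
Qed.

Lemma CInt_shift (f : R -> C) (v a b : R) : (a <= b)%R -> (forall x, Ccont f x) ->
  CInt (fun x => f (x + v)%R) a b = CInt f (a + v) (b + v).
Proof.
  intros Hab Hf.
  destruct (ex_RInt_Ccont f (1 * a + v) (1 * b + v) ltac:(lra) (fun x _ => Hf x)) as [H1 H2].
  replace (a + v)%R with (1 * a + v)%R by ring; replace (b + v)%R with (1 * b + v)%R by ring.
  apply C_eq; simpl; [rewrite <- (RInt_comp_lin _ _ _ _ _ H1)|rewrite <- (RInt_comp_lin _ _ _ _ _ H2)];
    apply RInt_ext; intros x _; rewrite !Rmult_1_l; reflexivity.
Qed.

(** The factor 2 comes from bounding the two components separately; it is harmless where the bound
    only has to tend to 0. *)
Lemma CInt_bound (f : R -> C) (a b M : R) : (a <= b)%R ->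
  (forall x, (a <= x <= b)%R -> Ccont f x) -> (forall x, (a <= x <= b)%R -> Cmod (f x) <= M)%R ->
  (Cmod (CInt f a b) <= 2 * ((b - a) * M))%R.
Proof.
  intros Hab Hf HM; destruct (ex_RInt_Ccont f a b Hab Hf) as [H1 H2].
  eapply Rle_trans; [apply Cmod_le_abs|]; simpl.
  assert (Rabs (RInt (fun x => fst (f x)) a b) <= (b - a) * M)%R.
  { apply abs_RInt_le_const; auto; intros x Hx; eapply Rle_trans; [apply fst_le_Cmod|auto]. }
  assert (Rabs (RInt (fun x => snd (f x)) a b) <= (b - a) * M)%R.
  { apply abs_RInt_le_const; auto; intros x Hx; eapply Rle_trans; [apply snd_le_Cmod|auto]. }
  lra.
Qed.

Lemma CInt_csum (p : nat -> R -> C) (a b : R) (N : nat) : (a <= b)%R ->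
  (forall n x, Ccont (p n) x) ->
  CInt (fun x => csum (fun n => p n x) N) a b = csum (fun n => CInt (p n) a b) N.
Proof.
  intros Hab H; induction N as [|N IH]; simpl.
  - apply C_eq; simpl; rewrite RInt_const; apply Rmult_0_r.
  - rewrite CInt_plus, IH; auto; intros x _; apply Ccont_csum; auto.
Qed.

Lemma CInt_zsum (p : Z -> R -> C) (a b : R) (N : nat) : (a <= b)%R ->
  (forall n x, Ccont (p n) x) ->
  CInt (fun x => zsum (fun n => p n x) N) a b = zsum (fun n => CInt (p n) a b) N.
Proof.
  intros Hab H; unfold zsum.
  rewrite (CInt_csum (fun n x => p (Z.of_nat n) x + p (- Z.of_nat n - 1)%Z x)); [|exact Hab|].
  - apply csum_ext; intros n; apply CInt_plus; auto.
  - intros n x; apply Ccont_plus; apply H.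
Qed.

Section UniformLimit.
Variables (fN : nat -> R -> C) (f : R -> C) (B r : R).
Hypothesis Hr : (0 <= r < 1)%R.
Hypothesis HfN : forall N x, Ccont (fN N) x.
Hypothesis Hlim : forall N x, (-1 <= x <= 2)%R -> (Cmod (fN N x - f x) <= B * r ^ N)%R.

(** The usual three-epsilon argument, for either component [p]. The rate is assumed on [[-1, 2]]
    because two-sided continuity at 0 and 1 needs room outside [[0, 1]]; hence the radius is cut at
    1. *)
Lemma uniform_limit_component (p : C -> R) :
  (forall z, Rabs (p z) <= Cmod z)%R -> (forall x y : C, p (Cminus x y) = (p x - p y)%R) ->
  (forall N x, continuous (fun y => p (fN N y)) x) ->
  forall x, (0 <= x <= 1)%R -> continuous (fun y => p (f y)) x.
Proof.
  intros Hp1 Hp2 Hc x Hx; apply filterlim_locally; intros eps.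
  assert (Hg := is_lim_seq_geom0 B r Hr); apply is_lim_seq_spec in Hg.
  assert (He : (0 < eps / 3)%R) by (pose proof (cond_pos eps); lra).
  destruct (Hg (mkposreal _ He)) as [N HN]; specialize (HN N (le_n N)); simpl in HN.
  rewrite Rminus_0_r in HN.
  assert (Hb : forall y, (-1 <= y <= 2)%R -> (Rabs (p (fN N y) - p (f y)) < eps / 3)%R).
  { intros y Hy; rewrite <- Hp2; eapply Rle_lt_trans; [apply Hp1|].
    eapply Rle_lt_trans; [apply Hlim, Hy|]; eapply Rle_lt_trans; [apply Rle_abs|exact HN]. }
  destruct (proj1 (filterlim_locally _ _) (Hc N x) (mkposreal _ He)) as [d Hd].
  assert (Hd1 : (0 < Rmin d 1)%R) by (apply Rmin_glb_lt; [apply cond_pos|lra]).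
  exists (mkposreal _ Hd1); intros y Hy.
  change (Rabs (y - x) < Rmin d 1)%R in Hy.
  assert (Hyd : (Rabs (y - x) < d)%R) by (eapply Rlt_le_trans; [exact Hy|apply Rmin_l]).
  assert (Hy1 : (Rabs (y - x) < 1)%R) by (eapply Rlt_le_trans; [exact Hy|apply Rmin_r]).
  specialize (Hd y Hyd); change (Rabs (p (fN N y) - p (fN N x)) < eps / 3)%R in Hd.
  change (Rabs (p (f y) - p (f x)) < eps)%R.
  apply Rabs_def2 in Hy1.
  pose proof (Rabs_def2 _ _ (Hb x ltac:(lra))); pose proof (Rabs_def2 _ _ (Hb y ltac:(lra))).
  apply Rabs_def2 in Hd; apply Rabs_def1; lra.
Qed.

Lemma uniform_limit_Ccont (x : R) : (0 <= x <= 1)%R -> Ccont f x.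
Proof.
  intros Hx; split.
  - apply (uniform_limit_component fst); auto; [apply fst_le_Cmod|].
    intros N y; apply HfN.
  - apply (uniform_limit_component snd); auto; [apply snd_le_Cmod|].
    intros N y; apply HfN.
Qed.

Lemma uniform_limit_CInt (g : R -> C) :
  (forall x, Ccont g x) -> (forall x, Cmod (g x) = 1%R) ->
  Ccv (fun N => CInt (fun x => fN N x * g x) 0 1) (CInt (fun x => f x * g x) 0 1).
Proof.
  intros Hg Hg1; apply (Ccv_geom_rate _ _ (2 * B) r Hr); intros N.
  assert (Hc1 : forall x, (0 <= x <= 1)%R -> Ccont (fun x => fN N x * g x) x).
  { intros x Hx; apply Ccont_mult; [apply HfN|apply Hg]. }
  assert (Hc2 : forall x, (0 <= x <= 1)%R -> Ccont (fun x => f x * g x) x).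
  { intros x Hx; apply Ccont_mult; [apply uniform_limit_Ccont, Hx|apply Hg]. }
  assert (Hc3 : forall x, (0 <= x <= 1)%R -> Ccont (fun x => -(1) * (f x * g x)) x).
  { intros x Hx; apply (Ccont_mult (fun _ => _)); [apply Ccont_const|apply Hc2, Hx]. }
  replace (CInt (fun x => fN N x * g x) 0 1 - CInt (fun x => f x * g x) 0 1)
    with (CInt (fun x => fN N x * g x + -(1) * (f x * g x)) 0 1).
  - eapply Rle_trans; [apply CInt_bound with (M := (B * r ^ N)%R)|]; try lra.
    + intros x Hx; apply Ccont_plus; auto.
    + intros x Hx; replace (fN N x * g x + -(1) * (f x * g x)) with ((fN N x - f x) * g x) by ring.
      rewrite Cmod_mult, Hg1, Rmult_1_r; apply Hlim; lra.
  - rewrite CInt_plus, CInt_scal by (auto; lra); ring.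
Qed.
End UniformLimit.

(** * Shifting the line of integration of a Gaussian *)

Open Scope R_scope.

Section GaussianShift.
(* [al + i be] is the exponent of the Gaussian and [ga + i de] its inverse;
   [h th x t] is the real part of [e^{i th} e^{- a (x + i pi t / a)^2}]. *)
Variables al be ga de : R.
Hypothesis Hal : 0 < al.
Hypothesis Hga : 0 < ga.
Hypothesis Hre : al * ga - be * de = 1.
Hypothesis Him : al * de + be * ga = 0.

Let Rp (x t : R) : R := - al * (x * x) + PI * PI * ga * (t * t).
Let Ip (x t : R) : R := - be * (x * x) + - (2 * PI * t * x) + PI * PI * de * (t * t).
Let h (th x t : R) : R := exp (Rp x t) * cos (Ip x t + th).
Let dh (th x t : R) : R := exp (Rp x t) *
  (2 * (PI * PI) * ga * t * cos (Ip x t + th)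
   - (- (2 * PI * x) + 2 * (PI * PI) * de * t) * sin (Ip x t + th)).
Let g (th t x : R) : R := exp (Rp x t) * (- PI * de * cos (Ip x t + th) - PI * ga * sin (Ip x t + th)).

Lemma gaussian_derive_t (th x t : R) : is_derive (fun u => h th x u) t (dh th x t).
Proof. unfold h, dh, Rp, Ip; auto_derive; trivial; ring. Qed.

(* By holomorphy the [t]-derivative of the shifted Gaussian is [i pi / a] times its [x]-derivative. *)
Lemma gaussian_primitive_derive (th x t : R) : is_derive (g th t) x (dh th x t).
Proof.
  unfold g, dh, Rp, Ip; auto_derive; trivial.
  set (E := exp _); set (Cc := cos _); set (Ss := sin _).
  transitivity (E * ((2 * PI * x * (al * de + be * ga) + 2 * (PI * PI) * ga * t) * Cc
    - (- (2 * PI * x * (al * ga - be * de)) + 2 * (PI * PI) * de * t) * Ss)).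
  - ring.
  - rewrite Him, Hre; ring.
Qed.

Lemma gaussian_continuous (th t x : R) : continuous (fun y => h th y t) x.
Proof. apply continuous_of_derive; unfold h, Rp, Ip; auto_derive; trivial. Qed.

Lemma gaussian_dt_continuous (th t x : R) : continuous (fun y => dh th y t) x.
Proof. apply continuous_of_derive; unfold dh, Rp, Ip; auto_derive; trivial. Qed.

Lemma gaussian_dt_continuity_2d (th x t : R) : continuity_2d_pt (fun u v => dh th v u) t x.
Proof.
  assert (HR : continuity_2d_pt (fun u v => Rp v u) t x).
  { unfold Rp; repeat first [apply continuity_2d_pt_plus | apply continuity_2d_pt_mult
      | apply continuity_2d_pt_opp | apply continuity_2d_pt_id1 | apply continuity_2d_pt_id2
      | apply continuity_2d_pt_const]. }
  assert (HI : continuity_2d_pt (fun u v => Ip v u + th) t x).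
  { unfold Ip; repeat first [apply continuity_2d_pt_plus | apply continuity_2d_pt_minus
      | apply continuity_2d_pt_mult | apply continuity_2d_pt_opp | apply continuity_2d_pt_id1
      | apply continuity_2d_pt_id2 | apply continuity_2d_pt_const]. }
  assert (HE := continuity_1d_2d_pt_comp exp _ t x (derivable_continuous _ derivable_exp _) HR).
  assert (HC := continuity_1d_2d_pt_comp cos _ t x (continuity_cos _) HI).
  assert (HS := continuity_1d_2d_pt_comp sin _ t x (continuity_sin _) HI).
  unfold dh; apply continuity_2d_pt_mult; [exact HE|].
  apply continuity_2d_pt_minus; apply continuity_2d_pt_mult; try exact HC; try exact HS;
    repeat first [apply continuity_2d_pt_plus | apply continuity_2d_pt_mult
      | apply continuity_2d_pt_opp | apply continuity_2d_pt_id1 | apply continuity_2d_pt_id2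
      | apply continuity_2d_pt_const].
Qed.

(** This plays the part of Cauchy's theorem on a rectangle: differentiate under the integral sign,
    then integrate the result in [x] by its primitive [g]. Only the contributions of the vertical
    sides [x = M] and [x = - M] remain. *)
Lemma shifted_integral_derive (th M t : R) : 0 <= M ->
  is_derive (fun u => RInt (fun x => h th x u) (- M) M) t (g th t M - g th t (- M)).
Proof.
  intros HM.
  replace (g th t M - g th t (- M)) with (RInt (fun x => Derive (fun u => h th x u) t) (- M) M).
  - apply (is_derive_RInt_param (fun u x => h th x u)).
    + apply filter_forall; intros u x _; exists (dh th x u); apply gaussian_derive_t.
    + intros x _; apply continuity_2d_pt_ext with (f := fun u v => dh th v u);
        [|apply gaussian_dt_continuity_2d].
      intros u v; symmetry; apply is_derive_unique, gaussian_derive_t.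
    + apply filter_forall; intros u; apply ex_RInt_continuous_le; [lra|].
      intros x _; apply gaussian_continuous.
  - rewrite (RInt_ext _ (fun x => dh th x t)) by (intros x _; apply is_derive_unique, gaussian_derive_t).
    apply is_RInt_unique, (is_RInt_derive (g th t)); intros x _;
      [apply gaussian_primitive_derive|apply gaussian_dt_continuous].
Qed.

Lemma gaussian_primitive_bound (th t x : R) : Rabs (g th t x) <= PI * (Rabs de + ga) * exp (Rp x t).
Proof.
  pose proof PI_RGT_0; unfold g; rewrite Rabs_mult, (Rabs_pos_eq (exp _)) by apply Rlt_le, exp_pos.
  rewrite Rmult_comm; apply Rmult_le_compat_r; [apply Rlt_le, exp_pos|].
  eapply Rle_trans; [apply Rabs_triang|]; rewrite Rabs_Ropp, !Rabs_mult, Rabs_Ropp.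
  rewrite (Rabs_pos_eq PI), (Rabs_pos_eq ga) by lra.
  pose proof (COS_bound (Ip x t + th)); pose proof (SIN_bound (Ip x t + th)).
  assert (Rabs (cos (Ip x t + th)) <= 1) by (apply Rabs_le; lra).
  assert (Rabs (sin (Ip x t + th)) <= 1) by (apply Rabs_le; lra).
  pose proof (Rabs_pos de).
  rewrite Rmult_plus_distr_l; apply Rplus_le_compat.
  - rewrite <- (Rmult_1_r (PI * Rabs de)) at 2; apply Rmult_le_compat_l; [nra|assumption].
  - rewrite <- (Rmult_1_r (PI * ga)) at 2; apply Rmult_le_compat_l; [nra|assumption].
Qed.

(** The mean value theorem in the shift parameter reduces the difference to the boundary terms at an
    intermediate [s] with [s^2 <= t^2], and these decay like [exp (- al * M^2)]. *)
Lemma shifted_integral_bound (th t M : R) : 0 <= M ->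
  Rabs (RInt (fun x => h th x t) (- M) M - RInt (fun x => h th x 0) (- M) M)
  <= 2 * PI * (Rabs de + ga) * exp (PI * PI * ga * (t * t)) * Rabs t * exp (- al * (M * M)).
Proof.
  intros HM; pose proof PI_RGT_0; pose proof (Rabs_pos de).
  destruct (MVT_gen (fun u => RInt (fun x => h th x u) (- M) M) 0 t
    (fun u => g th u M - g th u (- M))) as [s [Hs1 Hs2]].
  - intros u _; apply shifted_integral_derive, HM.
  - intros u _; apply continuity_pt_filterlim.
    apply (continuous_of_derive (fun v => RInt (fun x => h th x v) (- M) M)).
    exists (g th u M - g th u (- M)); apply shifted_integral_derive, HM.
  - rewrite Hs2, Rminus_0_r, Rabs_mult.
    assert (Hst : s * s <= t * t).
    { destruct (Rle_dec 0 t).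
      - rewrite Rmin_left, Rmax_right in Hs1 by lra; nra.
      - rewrite Rmin_right, Rmax_left in Hs1 by lra; nra. }
    assert (Hb : forall x, x * x = M * M -> Rabs (g th s x) <=
      PI * (Rabs de + ga) * (exp (PI * PI * ga * (t * t)) * exp (- al * (M * M)))).
    { intros x Hx; eapply Rle_trans; [apply gaussian_primitive_bound|].
      apply Rmult_le_compat_l; [nra|]; rewrite <- exp_plus; apply exp_le; unfold Rp; rewrite Hx.
      assert (PI * PI * ga * (s * s) <= PI * PI * ga * (t * t)); [|lra].
      apply Rmult_le_compat_l; [|exact Hst]; apply Rmult_le_pos; nra. }
    pose proof (Hb M eq_refl); pose proof (Hb (- M) ltac:(ring)).
    assert (Rabs (g th s M - g th s (- M)) <= 2 * PI * (Rabs de + ga) *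
      exp (PI * PI * ga * (t * t)) * exp (- al * (M * M))).
    { unfold Rminus; eapply Rle_trans; [apply Rabs_triang|]; rewrite Rabs_Ropp; lra. }
    replace (2 * PI * (Rabs de + ga) * exp (PI * PI * ga * (t * t)) * Rabs t * exp (- al * (M * M)))
      with (2 * PI * (Rabs de + ga) * exp (PI * PI * ga * (t * t)) * exp (- al * (M * M)) * Rabs t)
      by ring.
    apply Rmult_le_compat_r; [apply Rabs_pos|assumption].
Qed.

(** Only the difference is controlled here. That the truncated integrals converge is learned later,
    from the Fourier coefficients of the periodization. *)
Lemma shifted_integral_limit (th t : R) : is_lim_seq (fun N =>
  RInt (fun x => h th x t) (- INR N) (INR N) - RInt (fun x => h th x 0) (- INR N) (INR N)) 0.
Proof.
  apply is_lim_seq_abs_0.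
  apply is_lim_seq_le_le with (u := fun _ => 0) (w := fun N => 2 * PI * (Rabs de + ga) *
    exp (PI * PI * ga * (t * t)) * Rabs t * exp (- al) ^ N).
  - intros N; split; [apply Rabs_pos|]; eapply Rle_trans; [apply shifted_integral_bound, pos_INR|].
    apply Rmult_le_compat_l.
    + pose proof PI_RGT_0; pose proof (Rabs_pos de); pose proof (exp_pos (PI * PI * ga * (t * t))).
      apply Rmult_le_pos; [|apply Rabs_pos].
      apply Rmult_le_pos; [apply Rmult_le_pos|]; lra.
    + rewrite <- exp_mult_nat; apply exp_le.
      assert (HN : INR N <= INR N * INR N); [|assert (0 <= al * (INR N * INR N - INR N)) by
        (apply Rmult_le_pos; lra); lra].
      destruct N; [simpl; lra|]; rewrite S_INR; pose proof (pos_INR N); nra.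
  - apply is_lim_seq_const.
  - apply is_lim_seq_geom0; split; [apply Rlt_le, exp_pos|].
    rewrite <- exp_0; apply exp_increasing; lra.
Qed.
End GaussianShift.

Open Scope C_scope.

(** * Poisson summation for a Gaussian *)

(** One family, closed under products, that contains both the Gaussians and, for [w = 0] and
    imaginary [v], the characters. *)
Definition gau (w v : C) (y : R) : C := cexp (w * RtoC (y * y) + v * RtoC y).

Lemma gau_Ccont (w v : C) (x : R) : Ccont (gau w v) x.
Proof. split; apply continuous_of_derive; unfold gau, cexp, Re, Im; simpl; auto_derive; trivial. Qed.

Lemma gau_shift_Ccont (w v : C) (c x : R) : Ccont (fun y => gau w v (y + c)%R) x.
Proof. split; apply continuous_of_derive; unfold gau, cexp, Re, Im; simpl; auto_derive; trivial. Qed.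

Lemma Cmod_gau (w v : C) (y : R) : Cmod (gau w v y) = exp (fst w * (y * y) + fst v * y).
Proof. unfold gau; rewrite Cmod_cexp; f_equal; unfold Re; simpl; ring. Qed.

Lemma gau_mult (w v w' v' : C) (y : R) : gau w v y * gau w' v' y = gau (w + w') (v + v') y.
Proof. unfold gau; rewrite <- cexp_plus; f_equal; ring. Qed.

Lemma cexp_2PI_Z (k : Z) : cexp (0, (2 * PI * IZR k)%R) = 1.
Proof.
  assert (Hs : sin (PI * IZR k) = 0%R) by (apply sin_eq_0_1; exists k; ring).
  unfold cexp; simpl; rewrite exp_0, Rmult_assoc, cos_2a_sin, sin_2a, Hs; apply C_eq; simpl; ring.
Qed.

Lemma gau_periodic (k n : Z) (x : R) :
  gau 0 (0, (2 * PI * IZR k)%R) (x + IZR n) = gau 0 (0, (2 * PI * IZR k)%R) x.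
Proof.
  transitivity (gau 0 (0, (2 * PI * IZR k)%R) x * cexp (0, (2 * PI * IZR (k * n))%R)).
  - unfold gau; rewrite <- cexp_plus; f_equal; rewrite mult_IZR; apply C_eq; simpl; ring.
  - rewrite cexp_2PI_Z; ring.
Qed.

(** A total limit operator, so that sums of series depending on [x] can be named as functions of
    [x]. *)
Definition Clim (u : nat -> C) : C :=
  (real (Lim_seq (fun n => fst (u n))), real (Lim_seq (fun n => snd (u n)))).

Lemma Clim_eq (u : nat -> C) (l : C) : Ccv u l -> Clim u = l.
Proof.
  intros H; unfold Ccv in H.
  assert (Hp : forall (p : C -> R), (forall z, Rabs (p z) <= Cmod z)%R ->
    (forall x y : C, p (Cminus x y) = (p x - p y)%R) -> real (Lim_seq (fun n => p (u n))) = p l).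
  { intros p Hp1 Hp2; rewrite (is_lim_seq_unique _ (p l)); [reflexivity|].
    assert (H0 : is_lim_seq (fun n => p (u n) - p l)%R 0%R).
    { apply is_lim_seq_abs_0.
      apply is_lim_seq_le_le with (u := fun _ => 0%R) (2 := is_lim_seq_const 0) (3 := H).
      intros n; split; [apply Rabs_pos|]; rewrite <- Hp2; apply Hp1. }
    apply is_lim_seq_ext with (fun n => (p (u n) - p l) + p l)%R; [intros; ring|].
    replace (Finite (p l)) with (Finite (0 + p l)) by (f_equal; ring).
    apply is_lim_seq_plus'; [exact H0|apply is_lim_seq_const]. }
  apply C_eq; simpl; apply Hp; intros; try reflexivity; [apply fst_le_Cmod|apply snd_le_Cmod].
Qed.

(** From [(x + y)^2 >= y^2 / 2 - x^2], the difference being [(2x + y)^2 / 2]. The bound is uniform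
    for [|x| <= 2]. *)
Lemma exp_gauss_geom (c x y : R) (n : nat) : (0 < c)%R -> (-2 <= x <= 2)%R -> (INR n <= y * y)%R ->
  (exp (- c * ((x + y) * (x + y))) <= exp (4 * c) * exp (- (c / 2)) ^ n)%R.
Proof.
  intros Hc Hx Hn; rewrite <- exp_mult_nat, <- exp_plus; apply exp_le.
  assert (H : (INR n / 2 - 4 <= (x + y) * (x + y))%R).
  { assert (0 <= (2 * x + y) * (2 * x + y))%R by apply Rle_0_sqr.
    assert (x * x <= 4)%R by nra; nra. }
  assert (0 <= c * ((x + y) * (x + y) - (INR n / 2 - 4)))%R by (apply Rmult_le_pos; lra).
  lra.
Qed.

Lemma INR_le_sqr_Z (n : nat) :
  (INR n <= IZR (Z.of_nat n) * IZR (Z.of_nat n))%R /\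
  (INR n <= IZR (- Z.of_nat n - 1) * IZR (- Z.of_nat n - 1))%R.
Proof.
  rewrite minus_IZR, opp_IZR, <- INR_IZR_INZ; pose proof (pos_INR n); split; [|nra].
  destruct n; [simpl; lra|]; rewrite S_INR in *; pose proof (pos_INR n); nra.
Qed.

(** Only the moduli of the terms enter, so the same estimate serves the periodized Gaussian and its
    dual series. *)
Lemma gauss_series_limit (T : Z -> C) (c x : R) : (0 < c)%R -> (-2 <= x <= 2)%R ->
  (forall n, Cmod (T n) = exp (- c * ((x + IZR n) * (x + IZR n))))%R ->
  forall N, (Cmod (zsum T N - Clim (zsum T))
    <= 2 * exp (4 * c) / (1 - exp (- (c / 2))) * exp (- (c / 2)) ^ N)%R.
Proof.
  intros Hc Hx HT.
  assert (Hr : (0 <= exp (- (c / 2)) < 1)%R).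
  { split; [apply Rlt_le, exp_pos|]; rewrite <- exp_0; apply exp_increasing; lra. }
  destruct (csum_limit (fun n => T (Z.of_nat n) + T (- Z.of_nat n - 1)%Z)
    (2 * exp (4 * c)) (exp (- (c / 2))) Hr) as [l Hl].
  - intros n; eapply Rle_trans; [apply Cmod_triangle|]; rewrite !HT.
    destruct (INR_le_sqr_Z n) as [H1 H2].
    pose proof (exp_gauss_geom c x _ n Hc Hx H1); pose proof (exp_gauss_geom c x _ n Hc Hx H2); lra.
  - assert (Hcv : Ccv (zsum T) l) by (exact (Ccv_geom_rate _ _ _ _ Hr Hl)).
    rewrite (Clim_eq _ _ Hcv); exact Hl.
Qed.

Lemma zsum_single (c : C) (m : Z) (N : nat) : (Z.abs m < Z.of_nat N)%Z ->
  zsum (fun k => if Z.eqb k m then c else 0) N = c.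
Proof.
  intros Hm.
  assert (H : forall M, zsum (fun k => if Z.eqb k m then c else 0) M
    = if andb (- Z.of_nat M <=? m)%Z (m <? Z.of_nat M)%Z then c else 0).
  { induction M as [|M IH].
    - unfold zsum; simpl; destruct (Z.leb_spec 0 m); destruct (Z.ltb_spec m 0); simpl; trivial; lia.
    - rewrite zsum_S, IH.
      destruct (Z.leb_spec (- Z.of_nat M) m); destruct (Z.ltb_spec m (Z.of_nat M));
      destruct (Z.leb_spec (- Z.of_nat (S M)) m); destruct (Z.ltb_spec m (Z.of_nat (S M)));
      destruct (Z.eqb_spec (Z.of_nat M) m); destruct (Z.eqb_spec (- Z.of_nat M - 1) m);
      simpl; try ring; lia. }
  rewrite H.
  destruct (Z.leb_spec (- Z.of_nat N) m); destruct (Z.ltb_spec m (Z.of_nat N)); trivial; lia.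
Qed.

Lemma CInt_character (k : Z) :
  CInt (gau 0 (0, (2 * PI * IZR k)%R)) 0 1 = if Z.eqb k 0 then 1 else 0.
Proof.
  assert (Hg : forall x, gau 0 (0, (2 * PI * IZR k)%R) x
    = (cos (2 * PI * IZR k * x), sin (2 * PI * IZR k * x))%R).
  { intros x; unfold gau, cexp, Re, Im; simpl.
    replace (0 * (x * x) - 0 * 0 + (0 * x - 2 * PI * IZR k * 0))%R with 0%R by ring.
    replace (0 * 0 + 0 * (x * x) + (0 * 0 + 2 * PI * IZR k * x))%R with (2 * PI * IZR k * x)%R by ring.
    rewrite exp_0; apply C_eq; simpl; ring. }
  rewrite (CInt_ext _ _ 0 1 Hg); unfold CInt; simpl.
  destruct (Z.eqb_spec k 0) as [->|Hk].
  - apply C_eq; simpl.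
    + rewrite (RInt_ext _ (fun _ => 1%R)) by
        (intros x _; rewrite Rmult_0_r, Rmult_0_l; apply cos_0).
      rewrite RInt_const; unfold scal; simpl; unfold mult; simpl; ring.
    + rewrite (RInt_ext _ (fun _ => 0%R)) by
        (intros x _; rewrite Rmult_0_r, Rmult_0_l; apply sin_0).
      rewrite RInt_const; unfold scal; simpl; unfold mult; simpl; ring.
  - assert (Hw : (2 * PI * IZR k <> 0)%R).
    { pose proof PI_RGT_0; apply Rmult_integral_contrapositive; split; [lra|].
      apply not_0_IZR, Hk. }
    set (w := (2 * PI * IZR k)%R) in *.
    pose proof (cexp_2PI_Z k) as He; fold w in He; unfold cexp, Re, Im in He; simpl in He.
    rewrite exp_0, !Rmult_1_l in He; injection He as Hcos Hsin.
    apply C_eq; simpl.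
    + transitivity (minus (sin (w * 1) / w) (sin (w * 0) / w))%R.
      * apply is_RInt_unique, (is_RInt_derive (fun x => sin (w * x) / w)%R).
        -- intros x _; auto_derive; [exact I|field; exact Hw].
        -- intros x _; apply continuous_of_derive; auto_derive; trivial.
      * rewrite Rmult_1_r, Rmult_0_r, sin_0, Hsin; unfold minus, plus, opp; simpl; field; exact Hw.
    + transitivity (minus (- cos (w * 1) / w) (- cos (w * 0) / w))%R.
      * apply is_RInt_unique, (is_RInt_derive (fun x => - cos (w * x) / w)%R).
        -- intros x _; auto_derive; [exact I|field; exact Hw].
        -- intros x _; apply continuous_of_derive; auto_derive; trivial.
      * rewrite Rmult_1_r, Rmult_0_r, cos_0, Hcos; unfold minus, plus, opp; simpl; field; exact Hw.
Qed.

Lemma zsum_CInt_unit (G : R -> C) (N : nat) : (forall x, Ccont G x) ->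
  zsum (fun n => CInt G (IZR n) (IZR n + 1)) N = CInt G (- INR N) (INR N).
Proof.
  intros HG; induction N as [|N IH].
  - unfold zsum; simpl; rewrite Ropp_0; unfold CInt; rewrite !RInt_point; reflexivity.
  - rewrite zsum_S, IH, minus_IZR, opp_IZR, <- INR_IZR_INZ, S_INR; pose proof (pos_INR N).
    rewrite <- (CInt_Chasles G (- (INR N + 1)) (- INR N) (INR N + 1)) by (auto; lra).
    rewrite <- (CInt_Chasles G (- INR N) (INR N) (INR N + 1)) by (auto; lra).
    replace (- INR N - 1)%R with (- (INR N + 1))%R by ring.
    replace (- (INR N + 1) + 1)%R with (- INR N)%R by ring; ring.
Qed.

(** A single character mixes the components of [H]. Combining [m] with [- m] isolates the real
    factors cosine and sine, after which the real uniqueness result applies to each component. *)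
Lemma fourier_unique_complex (H : R -> C) :
  (forall x, (0 <= x <= 1)%R -> Ccont H x) ->
  (forall m : Z, CInt (fun x => H x * gau 0 (0, (2 * PI * IZR m)%R) x) 0 1 = 0) ->
  forall x0, (0 < x0 < 1)%R -> H x0 = 0.
Proof.
  intros HH H0 x0 Hx0; set (e := fun m : Z => gau 0 (0, (2 * PI * IZR m)%R)).
  change (forall m, CInt (fun x => H x * e m x) 0 1 = 0) in H0.
  assert (Hscal : forall (z : C) m x, (0 <= x <= 1)%R -> Ccont (fun x => z * (H x * e m x)) x).
  { intros z m x Hx; apply (Ccont_mult (fun _ => z)); [apply Ccont_const|].
    apply Ccont_mult; [apply HH, Hx|apply gau_Ccont]. }
  assert (Hcomb : forall (z z' : C) m n,
    CInt (fun x => z * (H x * e m x) + z' * (H x * e n x)) 0 1 = 0).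
  { intros z z' m n.
    assert (He : forall m x, (0 <= x <= 1)%R -> Ccont (fun x => H x * e m x) x).
    { intros l x Hx; apply Ccont_mult; [apply HH, Hx|apply gau_Ccont]. }
    rewrite (CInt_plus _ _ 0 1 Rle_0_1 (Hscal z m) (Hscal z' n)).
    rewrite (CInt_scal _ _ 0 1 Rle_0_1 (He m)), (CInt_scal _ _ 0 1 Rle_0_1 (He n)), !H0; ring. }
  assert (He : forall m x, e m x = (cos (2 * PI * IZR m * x), sin (2 * PI * IZR m * x))%R).
  { intros m x; unfold e, gau, cexp, Re, Im; simpl.
    replace (0 * (x * x) - 0 * 0 + (0 * x - 2 * PI * IZR m * 0))%R with 0%R by ring.
    replace (0 * 0 + 0 * (x * x) + (0 * 0 + 2 * PI * IZR m * x))%R with (2 * PI * IZR m * x)%R by ring.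
    rewrite exp_0; apply C_eq; simpl; ring. }
  assert (Hcos : forall m, CInt (fun x => RtoC (cos (2 * PI * IZR m * x)) * H x) 0 1 = 0).
  { intros m.
    transitivity (CInt (fun x => / 2 * (H x * e m x) + / 2 * (H x * e (- m)%Z x)) 0 1).
    - apply CInt_ext; intros x; rewrite !He, opp_IZR.
      replace (2 * PI * - IZR m * x)%R with (- (2 * PI * IZR m * x))%R by ring.
      rewrite cos_neg, sin_neg; destruct (H x) as [u v]; apply C_eq; simpl; field.
    - apply Hcomb. }
  assert (Hsin : forall m, CInt (fun x => RtoC (sin (2 * PI * IZR m * x)) * H x) 0 1 = 0).
  { intros m.
    transitivity (CInt (fun x => - Ci / 2 * (H x * e m x) + Ci / 2 * (H x * e (- m)%Z x)) 0 1).
    - apply CInt_ext; intros x; rewrite !He, opp_IZR.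
      replace (2 * PI * - IZR m * x)%R with (- (2 * PI * IZR m * x))%R by ring.
      rewrite cos_neg, sin_neg; destruct (H x) as [u v]; apply C_eq; simpl; field.
    - apply Hcomb. }
  assert (Hf : fst (H x0) = 0%R).
  { refine (fourier_unique (fun x => fst (H x)) (fun x Hx => proj1 (HH x Hx)) _ _ x0 Hx0); intros m.
    - transitivity (fst (CInt (fun x => RtoC (cos (2 * PI * IZR m * x)) * H x) 0 1));
        [apply RInt_ext; intros x _; simpl; ring|rewrite Hcos; reflexivity].
    - transitivity (fst (CInt (fun x => RtoC (sin (2 * PI * IZR m * x)) * H x) 0 1));
        [apply RInt_ext; intros x _; simpl; ring|rewrite Hsin; reflexivity]. }
  assert (Hs : snd (H x0) = 0%R).
  { refine (fourier_unique (fun x => snd (H x)) (fun x Hx => proj2 (HH x Hx)) _ _ x0 Hx0); intros m.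
    - transitivity (snd (CInt (fun x => RtoC (cos (2 * PI * IZR m * x)) * H x) 0 1));
        [apply RInt_ext; intros x _; simpl; ring|rewrite Hcos; reflexivity].
    - transitivity (snd (CInt (fun x => RtoC (sin (2 * PI * IZR m * x)) * H x) 0 1));
        [apply RInt_ext; intros x _; simpl; ring|rewrite Hsin; reflexivity]. }
  apply C_eq; [exact Hf|exact Hs].
Qed.

Section Poisson.
Variable a : C.
Hypothesis Ha : (0 < fst a)%R.

Let ia : C := / a.

Lemma exponent_neq_0 : a <> 0.
Proof. intros H; rewrite H in Ha; simpl in Ha; lra. Qed.

Lemma inv_exponent_pos : (0 < fst ia)%R.
Proof.
  unfold ia, Cinv; simpl; apply Rdiv_lt_0_compat; [exact Ha|nra].
Qed.

Lemma exponent_inv_re : (fst a * fst ia - snd a * snd ia = 1)%R.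
Proof. exact (f_equal fst (Cinv_r a exponent_neq_0)). Qed.

Lemma exponent_inv_im : (fst a * snd ia + snd a * fst ia = 0)%R.
Proof. exact (f_equal snd (Cinv_r a exponent_neq_0)). Qed.

(** [K t] is the truncated Fourier integral of the Gaussian at frequency [t], and [sh t] completes
    the square: [sh t * G t x = exp (- a (x + i pi t / a)^2)]. *)
Let G (t : R) : R -> C := gau (- a) (0, (- (2 * PI * t))%R).
Let K (t : R) (N : nat) : C := CInt (G t) (- INR N) (INR N).
Let sh (t : R) : C := cexp (RtoC (PI * PI * (t * t)) * ia).

Lemma neg_INR_le (N : nat) : (- INR N <= INR N)%R.
Proof. pose proof (pos_INR N); lra. Qed.

Lemma sh_G (t x : R) : sh t * G t x =
  let Rp := (- fst a * (x * x) + PI * PI * fst ia * (t * t))%R in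
  let Ip := (- snd a * (x * x) + - (2 * PI * t * x) + PI * PI * snd ia * (t * t))%R in
  (exp Rp * cos (Ip + 0), exp Rp * cos (Ip + - (PI / 2)))%R.
Proof.
  unfold sh, G, gau; rewrite <- cexp_plus; unfold cexp; cbv zeta.
  rewrite Rplus_0_r, <- (cos_neg (_ + - (PI / 2))), Ropp_plus_distr, Ropp_involutive.
  rewrite (Rplus_comm _ (PI / 2)).
  fold (Rminus (PI / 2) (- snd a * (x * x) + - (2 * PI * t * x) + PI * PI * snd ia * (t * t))).
  rewrite cos_shift.
  unfold Re, Im; simpl fst; simpl snd.
  apply C_eq; simpl fst; simpl snd; f_equal; f_equal; ring.
Qed.

(* [sh t * K t N] is the integral of the Gaussian along a horizontal line depending on [t]. *)
Lemma shifted_integrals_agree (t : R) : Ccv (fun N => sh t * K t N - K 0 N) 0.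
Proof.
  assert (Hsh0 : sh 0 = 1).
  { unfold sh; rewrite <- cexp_0; f_equal; rewrite Rmult_0_r, Rmult_0_r; ring. }
  assert (HJ : forall u N, sh u * K u N = CInt (fun x => sh u * G u x) (- INR N) (INR N)).
  { intros u N; unfold K; rewrite CInt_scal; [reflexivity|apply neg_INR_le|].
    intros x _; apply gau_Ccont. }
  apply Ccv_ext with (fun N => sh t * K t N - sh 0 * K 0 N).
  { intros N; rewrite Hsh0; ring. }
  apply Ccv_components.
  - apply is_lim_seq_ext with (2 := shifted_integral_limit _ _ _ _ Ha inv_exponent_pos
      exponent_inv_re exponent_inv_im 0 t).
    intros N; rewrite !HJ.
    apply (f_equal2 Rminus); apply RInt_ext; intros x _; rewrite sh_G; reflexivity.
  (* The phase [- PI / 2] replaces the real part by the imaginary part. *)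
  - apply is_lim_seq_ext with (2 := shifted_integral_limit _ _ _ _ Ha inv_exponent_pos
      exponent_inv_re exponent_inv_im (- (PI / 2)) t).
    intros N; rewrite !HJ.
    apply (f_equal2 Rminus); apply RInt_ext; intros x _; rewrite sh_G; reflexivity.
Qed.

(** The linear term [i pi] carries the sign [(-1)^n] and shifts every frequency by one half.
    Accordingly [p k] is the inverse of [sh (k - 1/2)]. *)
Let fterm (x : R) (n : Z) : C := gau (- a) (0, PI) (x + IZR n).
Let p (k : Z) : C := cexp (- (RtoC (PI * PI * ((IZR k - / 2) * (IZR k - / 2))) * ia)).
Let e (k : Z) : R -> C := gau 0 (0, (2 * PI * IZR k)%R).
Let pterm (x : R) (k : Z) : C := p k * e k x.
Let F (x : R) : C := Clim (zsum (fterm x)).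
Let P (x : R) : C := Clim (zsum (pterm x)).

Let BF : R := (2 * exp (4 * fst a) / (1 - exp (- (fst a / 2))))%R.
Let BP : R := (2 * exp (4 * (PI * PI * fst ia)) / (1 - exp (- (PI * PI * fst ia / 2))))%R.

Lemma Cmod_character (k : Z) (x : R) : Cmod (e k x) = 1%R.
Proof. unfold e; rewrite Cmod_gau; simpl; rewrite !Rmult_0_l, Rplus_0_r; apply exp_0. Qed.

Lemma periodization_rate (N : nat) (x : R) : (-1 <= x <= 2)%R ->
  (Cmod (zsum (fterm x) N - F x)
    <= BF * exp (- (fst a / 2)) ^ N)%R.
Proof.
  intros Hx; apply gauss_series_limit with (x := x); [exact Ha|lra|].
  intros n; unfold fterm; rewrite Cmod_gau; f_equal; simpl; ring.
Qed.

Lemma dual_series_rate (N : nat) (x : R) :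
  (Cmod (zsum (pterm x) N - P x)
    <= BP * exp (- (PI * PI * fst ia / 2)) ^ N)%R.
Proof.
  (* The characters have modulus 1, so the moduli of the terms form a Gaussian in [k - 1/2],
     whatever the point [x]. *)
  apply gauss_series_limit with (x := (- / 2)%R); [|lra|].
  - pose proof PI_RGT_0; pose proof inv_exponent_pos; apply Rmult_lt_0_compat; [nra|assumption].
  - intros n; unfold pterm, p; rewrite Cmod_mult, Cmod_character, Cmod_cexp, Rmult_1_r; f_equal.
    unfold Re; simpl; ring.
Qed.

Lemma gauss_ratio (c : R) : (0 < c)%R -> (0 <= exp (- (c / 2)) < 1)%R.
Proof.
  intros Hc; split; [apply Rlt_le, exp_pos|]; rewrite <- exp_0; apply exp_increasing; lra.
Qed.

Lemma fterm_Ccont (n : Z) (x : R) : Ccont (fun y => fterm y n) x.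
Proof. apply gau_shift_Ccont. Qed.

Lemma pterm_Ccont (k : Z) (x : R) : Ccont (fun y => pterm y k) x.
Proof. apply (Ccont_mult (fun _ => _)); [apply Ccont_const|apply gau_Ccont]. Qed.

Lemma dual_exponent_pos : (0 < PI * PI * fst ia)%R.
Proof. pose proof PI_RGT_0; pose proof inv_exponent_pos; apply Rmult_lt_0_compat; [nra|assumption]. Qed.

Lemma periodization_Ccont (x : R) : (0 <= x <= 1)%R -> Ccont F x.
Proof.
  apply (uniform_limit_Ccont (fun N y => zsum (fterm y) N) F BF _ (gauss_ratio _ Ha)).
  - intros N y; apply (Ccont_zsum (fun n z => fterm z n)); intros n; apply fterm_Ccont.
  - intros N y Hy; apply periodization_rate, Hy.
Qed.

Lemma dual_series_Ccont (x : R) : (0 <= x <= 1)%R -> Ccont P x.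
Proof.
  apply (uniform_limit_Ccont (fun N y => zsum (pterm y) N) P BP _ (gauss_ratio _ dual_exponent_pos)).
  - intros N y; apply (Ccont_zsum (fun n z => pterm z n)); intros n; apply pterm_Ccont.
  - intros N y Hy; apply dual_series_rate.
Qed.

(** Unfolding: the character is 1-periodic, so integrating the [N]-th partial sum over [[0, 1]]
    gives one integral over [[-N, N]]. The exponents [i pi] and [- 2 pi i m] combine into the
    frequency [m - 1/2]. *)
Lemma periodization_coefficient (m : Z) :
  Ccv (K (IZR m - / 2)) (CInt (fun x => F x * e (- m) x) 0 1).
Proof.
  pose proof (uniform_limit_CInt (fun N y => zsum (fterm y) N) F BF _ (gauss_ratio _ Ha)
    ltac:(intros N y; apply (Ccont_zsum (fun n z => fterm z n)); intros n; apply fterm_Ccont)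
    ltac:(intros N y Hy; apply periodization_rate, Hy) (e (- m))
    ltac:(intros y; apply gau_Ccont) (Cmod_character (- m))) as H.
  apply Ccv_ext with (2 := H); intros N.
  transitivity (CInt (fun x => zsum (fun n => G (IZR m - / 2) (x + IZR n)) N) 0 1).
  - apply CInt_ext; intros x; rewrite Cmult_comm, <- zsum_scal; apply zsum_ext; intros n.
    unfold fterm, e, G; rewrite <- (gau_periodic (- m) n x), gau_mult.
    f_equal; [ring|]; apply C_eq; simpl; [ring|rewrite opp_IZR; field].
  - rewrite (CInt_zsum (fun n x => G (IZR m - / 2) (x + IZR n))); [|lra|].
    + unfold K; rewrite <- zsum_CInt_unit by (intros; apply gau_Ccont).
      apply zsum_ext; intros n; rewrite CInt_shift; [|lra|intros; apply gau_Ccont].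
      f_equal; ring.
    + intros n x; apply gau_shift_Ccont.
Qed.

(** By orthogonality of characters the coefficient of a partial sum is exactly [p m] once the window
    contains [m]. *)
Lemma dual_series_coefficient (m : Z) : CInt (fun x => P x * e (- m) x) 0 1 = p m.
Proof.
  pose proof (uniform_limit_CInt (fun N y => zsum (pterm y) N) P BP _ (gauss_ratio _ dual_exponent_pos)
    ltac:(intros N y; apply (Ccont_zsum (fun n z => pterm z n)); intros n; apply pterm_Ccont)
    ltac:(intros N y Hy; apply dual_series_rate) (e (- m))
    ltac:(intros y; apply gau_Ccont) (Cmod_character (- m))) as H.
  apply (Ccv_unique _ _ _ H).
  apply Ccv_incr with (k := S (Z.to_nat (Z.abs m))).
  apply Ccv_ext with (2 := Ccv_const (p m)); intros N0.
  set (N := (N0 + S (Z.to_nat (Z.abs m)))%nat).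
  rewrite <- (zsum_single (p m) m N) by (unfold N; lia).
  transitivity (CInt (fun x => zsum (fun k => p k * e (k - m) x) N) 0 1).
  - rewrite (CInt_zsum (fun k x => p k * e (k - m) x)); [|lra|].
    + apply zsum_ext; intros k; rewrite CInt_scal; [|lra|intros; apply gau_Ccont].
      unfold e; rewrite CInt_character.
      destruct (Z.eqb_spec (k - m) 0); destruct (Z.eqb_spec k m) as [Hk|Hk]; try lia.
      * rewrite Hk; ring.
      * ring.
    + intros k x; apply (Ccont_mult (fun _ => _)); [apply Ccont_const|apply gau_Ccont].
  - apply CInt_ext; intros x; rewrite Cmult_comm, <- zsum_scal; apply zsum_ext; intros k.
    unfold pterm.
    replace (e (- m) x * (p k * e k x)) with (p k * (e k x * e (- m) x)) by ring.
    unfold e; rewrite gau_mult; f_equal; f_equal; [ring|].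
    apply C_eq; simpl; [ring|rewrite minus_IZR, opp_IZR; ring].
Qed.

(** All products [sh (m - 1/2) * K (m - 1/2)] have the same limit as [K 0], and [p m] inverts the
    first factor. Hence the coefficients of [F] are those of [A * P], and uniqueness applies to the
    continuous difference. *)
Lemma periodization_eq_dual : exists A : C, forall x, (0 < x < 1)%R -> F x = A * P x.
Proof.
  set (c := fun m => CInt (fun x => F x * e (- m) x) 0 1).
  (* [A] is the limit of [K 0], the Gaussian integral itself, reached through the coefficient [c 0]
     of frequency [- 1/2]. *)
  set (A := sh (0 - / 2) * c 0%Z).
  assert (Hshp : forall m, p m * sh (IZR m - / 2) = 1).
  { intros m; unfold p, sh; rewrite <- cexp_plus, <- cexp_0; f_equal; ring. }
  assert (Hc : forall m, c m = p m * A).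
  { intros m.
    assert (H1 : Ccv (K 0) A).
    { replace A with (A - 0) by ring.
      apply Ccv_ext with (fun N => sh (0 - / 2) * K (0 - / 2) N - (sh (0 - / 2) * K (0 - / 2) N - K 0 N)).
      - intros N; ring.
      - apply Ccv_minus; [|apply shifted_integrals_agree]; apply Ccv_scal, (periodization_coefficient 0). }
    assert (H2 : Ccv (fun N => sh (IZR m - / 2) * K (IZR m - / 2) N) (0 + A)).
    { apply Ccv_ext with (fun N => (sh (IZR m - / 2) * K (IZR m - / 2) N - K 0 N) + K 0 N).
      - intros N; ring.
      - apply Ccv_plus; [apply shifted_integrals_agree|exact H1]. }
    pose proof (Ccv_unique _ _ _ H2 (Ccv_scal _ _ _ (periodization_coefficient m))) as H3; fold (c m) in H3.
    replace (c m) with (p m * sh (IZR m - / 2) * c m) by (rewrite Hshp; ring).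
    rewrite <- Cmult_assoc, <- H3; ring. }
  exists A.
  set (H := fun x => F x + - A * P x).
  assert (HH : forall x, (0 <= x <= 1)%R -> Ccont H x).
  { intros x Hx; apply Ccont_plus; [apply periodization_Ccont, Hx|].
    apply (Ccont_mult (fun _ => - A)); [apply Ccont_const|apply dual_series_Ccont, Hx]. }
  assert (H0 : forall m, CInt (fun x => H x * e m x) 0 1 = 0).
  { intros m; replace m with (- - m)%Z by lia; set (k := (- m)%Z).
    transitivity (CInt (fun x => F x * e (- k) x + - A * (P x * e (- k) x)) 0 1).
    - apply CInt_ext; intros x; unfold H; ring.
    - assert (H1 : forall x, (0 <= x <= 1)%R -> Ccont (fun x => F x * e (- k) x) x).
      { intros x Hx; apply Ccont_mult; [apply periodization_Ccont, Hx|apply gau_Ccont]. }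
      assert (H2 : forall x, (0 <= x <= 1)%R -> Ccont (fun x => P x * e (- k) x) x).
      { intros x Hx; apply Ccont_mult; [apply dual_series_Ccont, Hx|apply gau_Ccont]. }
      assert (H3 : forall x, (0 <= x <= 1)%R -> Ccont (fun x => - A * (P x * e (- k) x)) x).
      { intros x Hx; apply (Ccont_mult (fun _ => - A)); [apply Ccont_const|apply H2, Hx]. }
      rewrite (CInt_plus _ _ 0 1 Rle_0_1 H1 H3), (CInt_scal _ _ 0 1 Rle_0_1 H2), dual_series_coefficient.
      fold (c k); rewrite Hc; ring. }
  intros x0 Hx0.
  assert (HHx : H x0 = 0) by (exact (fourier_unique_complex H HH H0 x0 Hx0)).
  replace (F x0) with (H x0 + A * P x0) by (unfold H; ring).
  rewrite HHx; ring.
Qed.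

Lemma poisson_gaussian : exists A : C, forall x, (0 < x < 1)%R -> exists S : C,
  Ccv (zsum (fun k => cexp (- (RtoC (PI * PI * ((IZR k - / 2) * (IZR k - / 2))) * / a))
    * gau 0 (0, (2 * PI * IZR k)%R) x)) S /\
  Ccv (zsum (fun n => gau (- a) (0, PI) (x + IZR n))) (A * S).
Proof.
  destruct periodization_eq_dual as [A HA]; exists A; intros x Hx; exists (P x); split.
  - eapply Ccv_geom_rate; [apply (gauss_ratio _ dual_exponent_pos)|intros N; apply dual_series_rate].
  - rewrite <- HA by exact Hx.
    eapply Ccv_geom_rate; [apply (gauss_ratio _ Ha)|intros N; apply periodization_rate; lra].
Qed.
End Poisson.

(** * Theta inversion *)

(* [w28 k] is the [k]-th power of a primitive 28th root of unity, so [zeta7 = w28 4]. *)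
Definition w28 (k : Z) : C := cexp (0, (PI * IZR k / 14)%R).
Definition c28 (k : Z) : C := w28 k + w28 (- k).

Lemma w28_plus (j k : Z) : w28 (j + k) = w28 j * w28 k.
Proof.
  unfold w28; rewrite <- cexp_plus; f_equal; rewrite plus_IZR; apply C_eq; simpl; field.
Qed.

Lemma w28_0 : w28 0 = 1.
Proof. unfold w28; rewrite <- cexp_0; f_equal; apply C_eq; simpl; field. Qed.

Lemma w28_14 : w28 14 = -(1).
Proof.
  unfold w28, cexp, Re, Im; simpl.
  replace (PI * 14 / 14)%R with PI by field; rewrite cos_PI, sin_PI, exp_0; apply C_eq; simpl; ring.
Qed.

Lemma w28_inv (k : Z) : / w28 k = w28 (- k).
Proof.
  assert (H : w28 k * w28 (- k) = 1) by (rewrite <- w28_plus, Z.add_opp_diag_r; apply w28_0).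
  assert (Hk : w28 k <> 0) by apply cexp_neq_0.
  replace (w28 (- k)) with (/ w28 k * (w28 k * w28 (- k))) by (field; exact Hk).
  rewrite H; ring.
Qed.

Lemma c28_mult (j k : Z) : c28 j * c28 k = c28 (j + k) + c28 (j - k).
Proof.
  unfold c28, Z.sub; rewrite !Z.opp_add_distr, Z.opp_involutive, !w28_plus; ring.
Qed.

Lemma c28_opp (k : Z) : c28 (- k) = c28 k.
Proof. unfold c28; rewrite Z.opp_involutive; ring. Qed.

Lemma c28_14_sub (k : Z) : c28 (14 - k) = - c28 k.
Proof.
  unfold c28, Z.sub; rewrite Z.opp_add_distr, Z.opp_involutive, !w28_plus, <- (w28_inv 14), w28_14.
  field; intros H; apply (f_equal fst) in H; simpl in H; lra.
Qed.

Lemma c28_7 : c28 7 = 0.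
Proof.
  pose proof (c28_14_sub 7) as H; simpl in H.
  replace (c28 7) with (/ 2 * (c28 7 + c28 7)) by field.
  rewrite H at 1; ring.
Qed.

Lemma cexp_PI_Z (n : Z) : cexp (0, (PI * IZR n)%R) = zsgn n.
Proof.
  unfold zsgn; destruct (Z.even n) eqn:En.
  - apply Z.even_spec in En; destruct En as [k ->].
    rewrite mult_IZR, <- (cexp_2PI_Z k); f_equal; apply C_eq; simpl; ring.
  - assert (Ho : Z.odd n = true) by (rewrite <- Z.negb_even, En; reflexivity).
    apply Z.odd_spec in Ho; destruct Ho as [k ->].
    rewrite <- w28_14, <- (Cmult_1_l (w28 14)), <- (cexp_2PI_Z k).
    unfold w28; rewrite <- cexp_plus; f_equal.
    rewrite plus_IZR, mult_IZR; apply C_eq; simpl; field.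
Qed.

Section ThetaTransformation.
Variable tau : C.
Hypothesis Htau : (0 < Im tau)%R.

Let tau' : C := Cdiv (RtoC (-1)) tau.
Let a : C := (0, (7 * PI)%R) / tau.

Lemma tau_neq_0 : tau <> 0.
Proof. intros H; rewrite H in Htau; simpl in Htau; lra. Qed.

Lemma Im_tau' : (0 < Im tau')%R.
Proof.
  unfold tau', Cdiv, Cinv, Im in *; simpl.
  replace (_ + _)%R with (snd tau / (fst tau * (fst tau * 1) + snd tau * (snd tau * 1)))%R
    by (unfold Rdiv; ring).
  apply Rdiv_lt_0_compat; [exact Htau|nra].
Qed.

Lemma theta_exponent_pos : (0 < fst a)%R.
Proof.
  pose proof PI_RGT_0; unfold a, Cdiv, Cinv, Im in *; simpl.
  replace (_ - _)%R with (7 * PI * snd tau / (fst tau * (fst tau * 1) + snd tau * (snd tau * 1)))%R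
    by (unfold Rdiv; ring).
  apply Rdiv_lt_0_compat; [apply Rmult_lt_0_compat; lra|nra].
Qed.

(** Since [1 / a = tau / (7 pi i)], the factor [exp (- pi^2 (k - 1/2)^2 / a)] is
    [q^((2k - 1)^2 / 56)]. The root of unity is the character at [x = i / 14] multiplied by
    [w28 (- i)]. *)
Let dual_term (i k : Z) : C :=
  w28 (i * (2 * k - 1)) * qpow (IZR (2 * k - 1) * IZR (2 * k - 1) / 56) tau.

Lemma theta_inversion : exists A : C, forall i : Z, (0 < i < 14)%Z -> exists S : C,
  Ccv (zsum (dual_term i)) S /\ Ccv (zsum (theta_term tau' (IZR i))) (A * S).
Proof.
  destruct (poisson_gaussian a theta_exponent_pos) as [A HA]; exists A; intros i Hi.
  pose proof tau_neq_0 as Ht.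
  destruct (HA (IZR i / 14)%R) as [S [HS1 HS2]].
  { destruct Hi as [H1 H2]; apply IZR_lt in H1, H2; lra. }
  (* At [x = i / 14] the factor [e^(i pi (x + n))] is [w28 i * (-1)^n]; multiplication by
     [w28 (- i)] leaves the sign alone. *)
  exists (w28 (- i) * S); split.
  - apply Ccv_ext with (2 := Ccv_scal (w28 (- i)) _ _ HS1); intros N.
    rewrite <- zsum_scal; apply zsum_ext; intros k.
    unfold dual_term, gau, w28, qpow; rewrite <- !cexp_plus; f_equal.
    transitivity (/ a * (- RtoC (PI * PI * ((IZR k - / 2) * (IZR k - / 2))))
      + (0, (PI * (IZR i * (2 * IZR k - 1)) / 14)%R)).
    { generalize (/ a); intros b; rewrite opp_IZR; apply C_eq; simpl; field. }
    replace (/ a) with (tau * (0, (- / (7 * PI))%R)).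
    + rewrite mult_IZR, minus_IZR, mult_IZR; pose proof PI_RGT_0.
      apply C_eq; simpl; field; lra.
    + unfold a; pose proof PI_RGT_0.
      assert (HI : (0, (- / (7 * PI))%R) = / (0, (7 * PI)%R) :> C).
      { apply C_eq; simpl; field; lra. }
      rewrite HI; field; split; [exact Ht|].
      intros H0; apply (f_equal snd) in H0; simpl in H0; lra.
  - replace (A * (w28 (- i) * S)) with (w28 (- i) * (A * S)) by ring.
    apply Ccv_ext with (2 := Ccv_scal (w28 (- i)) _ _ HS2); intros N.
    rewrite <- zsum_scal; apply zsum_ext; intros n.
    unfold theta_term; rewrite <- cexp_PI_Z.
    unfold gau, w28, qpow; rewrite <- !cexp_plus; f_equal.
    rewrite opp_IZR.
    transitivity ((0, (PI * IZR n)%R)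
      + / tau * (0, (- (7 * PI * ((IZR i / 14 + IZR n) * (IZR i / 14 + IZR n))))%R)).
    + replace (- a) with (/ tau * (0, (- (7 * PI))%R)).
      * generalize (/ tau); intros b; apply C_eq; simpl; field.
      * unfold a, Cdiv; rewrite Cmult_comm.
        replace ((0, (- (7 * PI))%R) : C) with (- ((0, (7 * PI)%R) : C)).
        -- ring.
        -- apply C_eq; simpl; ring.
    + unfold tau', Cdiv.
      replace ((0, (2 * PI * ((14 * IZR n + IZR i) * (14 * IZR n + IZR i) / 56))%R) * (RtoC (-1) * / tau))
        with (/ tau * (RtoC (-1) * (0, (2 * PI * ((14 * IZR n + IZR i) * (14 * IZR n + IZR i) / 56))%R)))
        by ring.
      f_equal; f_equal; apply C_eq; simpl; field.
Qed.

(** The map [n -> - n - 1] sends [14n + i] to the negative of [14n + (14 - i)] and changes the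
    parity of [n]. *)
Lemma theta_term_reflect (i : R) (n : Z) :
  theta_term tau i (- n - 1) = -(1) * theta_term tau (14 - i) n.
Proof.
  unfold theta_term; rewrite zsgn_pred, zsgn_opp.
  replace ((14 * IZR (- n - 1) + i) * (14 * IZR (- n - 1) + i) / 56)%R
    with ((14 * IZR n + (14 - i)) * (14 * IZR n + (14 - i)) / 56)%R
    by (rewrite minus_IZR, opp_IZR; field).
  ring.
Qed.

Lemma theta_limit_reflect (i : R) (T : C) :
  Ccv (zsum (theta_term tau i)) T -> Ccv (zsum (theta_term tau (14 - i))) (- T).
Proof.
  intros H; replace (- T) with (-(1) * T) by ring.
  apply Ccv_ext with (2 := Ccv_scal (-(1)) _ _ H); intros N.
  rewrite <- (zsum_reflect (theta_term tau i)), <- zsum_scal; apply zsum_ext; intros n.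
  rewrite theta_term_reflect; ring.
Qed.

(** The substitution [n -> - n] does not preserve the window. It is the window reflection followed
    by a shift by one, whose two boundary terms tend to 0. *)
Lemma theta_limit_neg1 (T : C) :
  Ccv (zsum (theta_term tau 1)) T -> Ccv (zsum (theta_term tau (-1))) T.
Proof.
  intros H; pose proof (rho_bounds tau Htau) as Hr.
  assert (H0 : forall f : nat -> Z,
    (forall N, INR N <= (14 * IZR (f N) + 1) * (14 * IZR (f N) + 1) / 56)%R ->
    Ccv (fun N => theta_term tau 1 (f N)) 0).
  { intros f Hf; apply Ccv_geom_rate with (A := 1%R) (r := exp (- (2 * PI * Im tau))); [lra|].
    intros N; unfold theta_term; replace (_ - 0) with (zsgn (f N) *
      qpow ((14 * IZR (f N) + 1) * (14 * IZR (f N) + 1) / 56) tau) by ring.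
    rewrite Cmod_mult, Cmod_zsgn; apply Rmult_le_compat_l; [lra|].
    apply (Cmod_qpow_le tau Htau), Hf. }
  replace T with (T + 0 - 0) by ring.
  apply Ccv_ext with (fun N => zsum (theta_term tau 1) N + theta_term tau 1 (Z.of_nat N)
    - theta_term tau 1 (- Z.of_nat N)).
  - intros N; rewrite <- zsum_shift, <- (zsum_reflect (theta_term tau (-1))).
    apply zsum_ext; intros n; unfold theta_term; f_equal.
    + rewrite zsgn_succ, zsgn_pred, zsgn_opp; reflexivity.
    + f_equal; rewrite plus_IZR, minus_IZR, opp_IZR; field.
  - apply Ccv_minus; [apply Ccv_plus; [exact H|]|]; apply H0; intros N;
      rewrite ?opp_IZR, <- INR_IZR_INZ; pose proof (pos_INR N).
    + pose proof (Rle_0_sqr (14 * INR N - 1)); unfold Rsqr in *; lra.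
    + destruct N; [simpl; lra|]; rewrite S_INR in *; pose proof (pos_INR N); nra.
Qed.

(** Here [2 (7m + r) - 1 = 14m + (2r - 1)]. As [2j + 1] is odd, the additional root of unity
    [(-1)^((2j + 1) m)] is exactly the sign [(-1)^m] of a theta term. *)
Lemma dual_term_mod7 (j m r : Z) :
  dual_term (2 * j + 1) (7 * m + r) =
  w28 ((2 * j + 1) * (2 * r - 1)) * theta_term tau (IZR (2 * r - 1)) m.
Proof.
  unfold dual_term, theta_term.
  replace ((2 * j + 1) * (2 * (7 * m + r) - 1))%Z
    with ((2 * j + 1) * (2 * r - 1) + 14 * ((2 * j + 1) * m))%Z by ring.
  rewrite w28_plus.
  replace (w28 (14 * ((2 * j + 1) * m))) with (zsgn m).
  - replace (2 * (7 * m + r) - 1)%Z with (14 * m + (2 * r - 1))%Z by ring.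
    rewrite plus_IZR, (mult_IZR 14); ring.
  - transitivity (zsgn ((2 * j + 1) * m)).
    + unfold zsgn; rewrite Z.even_mul, Z.even_add, Z.even_mul; reflexivity.
    + rewrite <- cexp_PI_Z; unfold w28; f_equal; rewrite (mult_IZR 14); apply C_eq; simpl; field.
Qed.

(** The classes [r = 0, ..., 6] give the indices [-1, 1, 3, 5, 7, 9, 11]. Reflection gives
    [T_(-1) = T1], [T_7 = 0], [T_9 = - T5] and [T_11 = - T3], and the roots of unity pair up into
    cosines. *)
Lemma dual_sum_limit (j : Z) (S T1 T3 T5 : C) :
  Ccv (zsum (dual_term (2 * j + 1))) S ->
  Ccv (zsum (theta_term tau 1)) T1 -> Ccv (zsum (theta_term tau 3)) T3 ->
  Ccv (zsum (theta_term tau 5)) T5 ->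
  S = c28 (2 * j + 1) * T1 + c28 (3 * (2 * j + 1)) * T3 + c28 (5 * (2 * j + 1)) * T5.
Proof.
  intros HS H1 H3 H5; set (i := (2 * j + 1)%Z) in *.
  pose proof (theta_limit_neg1 _ H1) as Hm1.
  pose proof (theta_limit_reflect _ _ H5) as H9; replace (14 - 5)%R with 9%R in H9 by ring.
  pose proof (theta_limit_reflect _ _ H3) as H11; replace (14 - 3)%R with 11%R in H11 by ring.
  assert (H7 : Ccv (zsum (theta_term tau 7)) 0).
  { apply Ccv_ext with (2 := Ccv_const 0); intros N.
    pose proof (zsum_reflect (theta_term tau 7) N) as H.
    rewrite (zsum_ext _ (fun n => -(1) * theta_term tau 7 n)) in H.
    - rewrite zsum_scal in H; set (z := zsum _ N) in *.
      replace z with (/ 2 * (z + z)) by field; rewrite <- H at 1; ring.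
    - intros n; rewrite theta_term_reflect; do 2 f_equal; ring. }
  (* For odd [i] this turns the coefficients of indices 9 and 11 into the conjugates of those of
     indices 5 and 3, absorbing the signs from reflection. *)
  assert (Hw : forall k, - w28 (i * (14 - k)) = w28 (- (i * k))).
  { intros k; replace (i * (14 - k))%Z with (14 * i + - (i * k))%Z by ring; rewrite w28_plus.
    replace (w28 (14 * i)) with (-(1)); [ring|].
    transitivity (zsgn i).
    - unfold i, zsgn; rewrite Z.even_add, Z.even_mul; reflexivity.
    - rewrite <- cexp_PI_Z; unfold w28; f_equal; rewrite (mult_IZR 14); apply C_eq; simpl; field. }
  assert (Hsum : Ccv (fun N => zsum (dual_term i) (7 * N))
    (w28 (i * -1) * T1 + w28 (i * 1) * T1 + w28 (i * 3) * T3 + w28 (i * 5) * T5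
     + w28 (i * 7) * 0 + w28 (i * 9) * - T5 + w28 (i * 11) * - T3)).
  { apply Ccv_ext with (fun N => w28 (i * -1) * zsum (theta_term tau (-1)) N
      + w28 (i * 1) * zsum (theta_term tau 1) N + w28 (i * 3) * zsum (theta_term tau 3) N
      + w28 (i * 5) * zsum (theta_term tau 5) N + w28 (i * 7) * zsum (theta_term tau 7) N
      + w28 (i * 9) * zsum (theta_term tau 9) N + w28 (i * 11) * zsum (theta_term tau 11) N).
    - intros N; rewrite zsum_mod7, <- !zsum_scal, <- !zsum_plus; apply zsum_ext; intros m.
      replace (7 * m)%Z with (7 * m + 0)%Z at 1 by ring.
      unfold i; rewrite !dual_term_mod7; reflexivity.
    - repeat apply Ccv_plus; apply Ccv_scal; assumption. }
  assert (Hsub : Ccv (fun N => zsum (dual_term i) (7 * N)) S)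
    by (apply (Ccv_subseq _ S (fun N => 7 * N)%nat); [intros; lia|exact HS]).
  rewrite (Ccv_unique _ _ _ Hsub Hsum).
  pose proof (Hw 5%Z) as W5; pose proof (Hw 3%Z) as W3; simpl in W5, W3.
  unfold c28.
  replace (- (3 * i))%Z with (- (i * 3))%Z by ring; replace (- (5 * i))%Z with (- (i * 5))%Z by ring.
  rewrite <- W5, <- W3.
  replace (i * -1)%Z with (- i)%Z by ring; replace (i * 1)%Z with i by ring.
  replace (3 * i)%Z with (i * 3)%Z by ring; replace (5 * i)%Z with (i * 5)%Z by ring.
  ring.
Qed.
End ThetaTransformation.

(** * Cosine relations and the transformation of s and t *)

Lemma eta_c28 (i : nat) : eta i = c28 (4 * Z.of_nat i).
Proof.
  assert (Hp : Cpow zeta7 i = w28 (4 * Z.of_nat i)).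
  { induction i as [|i IH]; [symmetry; apply w28_0|].
    replace (4 * Z.of_nat (S i))%Z with (4 + 4 * Z.of_nat i)%Z by lia.
    rewrite w28_plus, <- IH; simpl; f_equal.
    unfold zeta7, w28; f_equal; apply C_eq; simpl; field. }
  unfold eta, c28; rewrite Hp, w28_inv; reflexivity.
Qed.

Theorem theorem2 (tau : C) (Htau : (0 < Im tau)%R) :
  let s := s_fun tau in
  let t := t_fun tau in
  let tau' := Cdiv (RtoC (-1)) tau in
  let c := eps1 * eps1 - eps1 - 1 in
  s_fun tau' = (eps1 * s - eta 3 * t + 1) / (s - eps1 * t - eta 3) /\
  s_fun tau' = (eps1 * s + c * t + 1) / (s - eps1 * t + c) /\
  t_fun tau' = (- eta 3 * s - t - eps1) / (s - eps1 * t - eta 3) /\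
  t_fun tau' = (c * s - t - eps1) / (s - eps1 * t + c).
Proof.
  cbv zeta.
  destruct (theta_quotients tau Htau) as [T1 [T3 [T5 [H1 [H3 [H5 [HT5 [-> ->]]]]]]]].
  destruct (theta_quotients _ (Im_tau' tau Htau)) as [U1 [U3 [U5 [K1 [K3 [K5 [HU5 [-> ->]]]]]]]].
  destruct (theta_inversion tau Htau) as [A HA].
  assert (HU : forall j U, (0 <= j <= 2)%Z ->
    Ccv (zsum (theta_term (Cdiv (RtoC (-1)) tau) (IZR (2 * j + 1)))) U ->
    U = A * (c28 (2 * j + 1) * T1 + c28 (3 * (2 * j + 1)) * T3 + c28 (5 * (2 * j + 1)) * T5)).
  { intros j U Hj HU; destruct (HA (2 * j + 1)%Z ltac:(lia)) as [S [HS1 HS2]].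
    rewrite <- (dual_sum_limit tau Htau j S T1 T3 T5 HS1 H1 H3 H5).
    exact (Ccv_unique _ _ _ HU HS2). }
  pose proof (HU 0%Z U1 ltac:(lia) K1) as E1; pose proof (HU 1%Z U3 ltac:(lia) K3) as E3.
  pose proof (HU 2%Z U5 ltac:(lia) K5) as E5; simpl in E1, E3, E5; clear HU.
  (* Evenness and [c_(14 - k) = - c_k] reduce the multipliers 9, 15 and 25 to [- c_5], [- c_1] and
     [c_3]. *)
  pose proof (c28_14_sub 5) as C9; pose proof (c28_14_sub (-1)) as C15; simpl in C9, C15.
  pose proof (c28_14_sub (-3)) as C17; pose proof (c28_14_sub (-11)) as C25; simpl in C17, C25.
  pose proof (c28_14_sub 3) as C11; pose proof (c28_14_sub 1) as C13; simpl in C11, C13.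
  pose proof (c28_opp 1) as N1; pose proof (c28_opp 3) as N3; pose proof (c28_opp 11) as N11.
  pose proof (c28_opp 7) as N7; simpl in N1, N3, N11, N7.
  rewrite N1 in C15; rewrite N3 in C17; rewrite N11, C11 in C25; rewrite c28_7 in N7.
  pose proof (c28_mult 5 4) as M54; pose proof (c28_mult 5 8) as M58.
  pose proof (c28_mult 5 12) as M512; pose proof (c28_mult 4 4) as M44; simpl in M54, M58, M512, M44.
  rewrite C9 in M54; rewrite C13, N3 in M58; rewrite C17, N7 in M512.
  assert (C0 : c28 0 = 2) by (unfold c28; simpl; rewrite w28_0; ring).
  rewrite C0 in M44.
  assert (Heps : eps1 = 1 + c28 4) by (unfold eps1; rewrite eta_c28; reflexivity).
  assert (Heta : eta 3 = c28 12) by apply (eta_c28 3).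
  (* [c_5 c_4 = c_9 + c_1 = - c_5 + c_1] gives the first relation;
     [c_5 c_12 = c_17 + c_(-7) = - c_3] gives the second. *)
  assert (X1 : c28 1 = c28 5 * eps1).
  { rewrite Heps; replace (c28 1) with (c28 5 + (- c28 5 + c28 1)) by ring.
    rewrite <- M54; ring. }
  assert (X3 : c28 3 = - (c28 5 * eta 3)) by (rewrite Heta, M512; ring).
  rewrite C15, C9, X1, X3 in E3; rewrite C15, C25, X1, X3 in E5; rewrite X1, X3 in E1.
  assert (F1 : U1 = A * c28 5 * (eps1 * T1 - eta 3 * T3 + T5)) by (rewrite E1; ring).
  assert (F3 : U3 = A * c28 5 * (- eta 3 * T1 - T3 - eps1 * T5)) by (rewrite E3; ring).
  assert (F5 : U5 = A * c28 5 * (T1 - eps1 * T3 - eta 3 * T5)) by (rewrite E5; ring).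
  assert (HA0 : A <> 0) by (intros H0; apply HU5; rewrite F5, H0; ring).
  (* The common factor [c28 5] is nonzero for the same reason as [A], so no numerical estimate of a
     cosine is needed. *)
  assert (Hc5 : c28 5 <> 0) by (intros H0; apply HU5; rewrite F5, H0; ring).
  assert (HY : T1 - eps1 * T3 - eta 3 * T5 <> 0) by (intros H0; apply HU5; rewrite F5, H0; ring).
  assert (Hc : eps1 * eps1 - eps1 - 1 = - eta 3).
  (* This is [1 + eta_1 + eta_2 + eta_3 = 0], the vanishing sum of the seventh roots of unity. After
     multiplication by [c_5] the left part telescopes: [c_5 + (c_1 - c_5) + (c_3 - c_1) = c_3 = -
     c_5 eta_3]. *)
  { replace (eps1 * eps1 - eps1 - 1) with (1 + c28 4 + c28 8)
      by (rewrite Heps; replace (c28 8) with (c28 8 + 2 - 2) by ring; rewrite <- M44; ring).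
    replace (1 + c28 4 + c28 8) with (/ c28 5 * (c28 5 + c28 5 * c28 4 + c28 5 * c28 8))
      by (field; exact Hc5).
    rewrite M54, M58, X3; field; exact Hc5. }
  rewrite Hc.
  assert (Es : U1 / U5 = (eps1 * (T1 / T5) - eta 3 * (T3 / T5) + 1)
    / (T1 / T5 - eps1 * (T3 / T5) - eta 3)).
  { rewrite F1, F5; field; auto. }
  assert (Et : U3 / U5 = (- eta 3 * (T1 / T5) - T3 / T5 - eps1)
    / (T1 / T5 - eps1 * (T3 / T5) - eta 3)).
  { rewrite F3, F5; field; auto. }
  replace (eps1 * (T1 / T5) + - eta 3 * (T3 / T5) + 1)
    with (eps1 * (T1 / T5) - eta 3 * (T3 / T5) + 1) by ring.
  replace (T1 / T5 - eps1 * (T3 / T5) + - eta 3) with (T1 / T5 - eps1 * (T3 / T5) - eta 3) by ring.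
  repeat split; assumption.
Qed.
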